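(* Let $\sigma:\mathbb R\to\mathbb R$ be continuous and not a polynomial. Consider the class of pairs $(\mathcal X,\mathcal N(\mathcal X))$ consisting of a compact metric space and a set of real functions on it, generated by the following rules: (i) if $\mathcal X\subset\mathbb R^d$ is compact ($d\in\mathbb N$), then $(\mathcal X,\mathcal N(\mathcal X))$ is in the class with $\mathcal N(\mathcal X)=\{x\mapsto\sum_{i=1}^n\alpha_i\sigma(w_i^{\mathrm T}x+b_i):n\in\mathbb N,\alpha_i,b_i\in\mathbb R,w_i\in\mathbb R^d\}$; (ii) if $(\mathcal X_1,\mathcal N(\mathcal X_1)),\dots,(\mathcal X_l,\mathcal N(\mathcal X_l))$ are in the class, then so is $(\mathcal X_1\times\cdots\times\mathcal X_l,\mathcal N)$ with $\mathcal N$ the set of functions $(x_1,\dots,x_l)\mapsto\sum_{i=1}^n\alpha_i\sigma\big(b_i+\sum_{j=1}^l w_{ij}a_{ij}(x_j)\big)$, $n\in\mathbb N$, $\alpha_i,b_i,w_{ij}\in\mathbb R$, $a_{ij}\in\mathcal N(\mathcal X_j)$; (iii) if $(\mathcal X,\mathcal N(\mathcal X))$ is in the class, then so is $(\mathcal P(\mathcal X),\mathcal N)$ with $\mathcal N$ the set of functions $p\mapsto\sum_{i=1}^n\alpha_i\sigma\big(b_i+\sum_{k=1}^{m_i}w_{ik}\int f_{ik}\,\mathrm dp\big)$, $n,m_i\in\mathbb N$, $\alpha_i,b_i,w_{ik}\in\mathbb R$, $f_{ik}\in\mathcal N(\mathcal X)$. Then for every pair $(\mathcal X,\mathcal N(\mathcal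 X))$ in this class, $\mathcal N(\mathcal X)$ is dense in $C(\mathcal X)$ with respect to the supremum metric.
   Context: For a compact metric space $\mathcal X$, $C(\mathcal X)$ is the space of continuous real functions with the supremum metric. $\mathcal P(\mathcal X)$ is the set of all Borel probability measures on $\mathcal X$, endowed with the metric $\rho^*(p,q)=\sum_{n}2^{-n}\big|\int f_n\,\mathrm dp-\int f_n\,\mathrm dq\big|$ for a fixed dense sequence $\{f_n\}\subset C(\mathcal X)$; this metrizes the weak* topology and makes $\mathcal P(\mathcal X)$ a compact metric space. Finite products carry the product topology (with any compatible metric). *)

(* Defs.v *)
From HB Require Import structures.
From mathcomp Require Import all_boot all_order all_algebra.
From mathcomp Require Import all_classical all_reals all_analysis.
Unset Printing Implicit Defensive.
Import Order.TTheory GRing.Theory Num.Theory.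
Import numFieldNormedType.Exports.
Local Open Scope classical_set_scope.
Local Open Scope ring_scope.

Record cspace (R : realType) := Space {
  car : Type;
  opn : set (set car);
  nets : set (car -> R) }.
Arguments car {R}. Arguments opn {R}. Arguments nets {R}.

Section Spaces.
Variables (R : realType) (sigma : R -> R).

Definition cont {X : cspace R} (f : car X -> R) : Prop :=
  forall V : set R, open V -> opn X (f @^-1` V).

Definition base_space {d : nat} (K : set 'rV[R]_d) : cspace R :=
  @Space R {x : 'rV[R]_d | K x}
    [set U | exists V : set 'rV[R]_d, open V /\
             U = [set x : {x : 'rV[R]_d | K x} | V (sval x)]]
    [set g : {x : 'rV[R]_d | K x} -> R | exists (n : nat) (alpha b : 'I_n -> R) (w : 'I_n -> 'rV[R]_d),
       forall x : {x : 'rV[R]_d | K x}, g x = \sum_(i < n) alpha i *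
          sigma (\sum_(k < d) w i 0 k * (sval x) 0 k + b i)].

Definition prod_space {l : nat} (X : 'I_l -> cspace R) : cspace R :=
  @Space R (forall j : 'I_l, car (X j))
    [set U | forall x, U x -> exists V : forall j, set (car (X j)),
        (forall j, opn (X j) (V j) /\ V j (x j)) /\
        (forall y, (forall j, V j (y j)) -> U y)]
    [set g | exists (n : nat) (alpha b : 'I_n -> R) (w : 'I_n -> 'I_l -> R)
       (a : forall (i : 'I_n) (j : 'I_l), car (X j) -> R),
       (forall i j, nets (X j) (a i j)) /\
       forall x, g x = \sum_(i < n) alpha i *
          sigma (b i + \sum_(j < l) w i j * a i j (x j))].

(* the carrier of X made into a pointedType (needed by the measure library) *)
Definition ptd {T : Type} (x0 : T) : pointedType :=
  HB.pack T (gen_eqMixin T) (gen_choiceMixin T) (isPointed.Build T x0).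

Definition borel_of {X : cspace R} (x0 : car X) :=
  g_sigma_algebraType (opn X : set (set (ptd x0))).

Definition integ {X : cspace R} {x0 : car X}
  (p : probability (borel_of x0) R) (f : car X -> R) : R :=
  fine (\int[p]_x (f x)%:E).

Definition meas_space {X : cspace R} (x0 : car X) : cspace R :=
  @Space R (probability (borel_of x0) R)
    [set U | forall p, U p -> exists (k : nat) (f : 'I_k -> car X -> R)
        (delta : R), 0 < delta /\ (forall i, cont (f i)) /\
        (forall q, (forall i, `|integ q (f i) - integ p (f i)| < delta) -> U q)]
    [set g | exists (n : nat) (alpha b : 'I_n -> R) (m : 'I_n -> nat)
       (w : forall i : 'I_n, 'I_(m i) -> R)
       (f : forall i : 'I_n, 'I_(m i) -> car X -> R),
       (forall i k, nets X (f i k)) /\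
       forall p, g p = \sum_(i < n) alpha i *
          sigma (b i + \sum_(k < m i) w i k * integ p (f i k))].

Inductive InClass : cspace R -> Prop :=
| in_base (d : nat) (K : set 'rV[R]_d) :
    compact K -> InClass (base_space K)
| in_prod (l : nat) (X : 'I_l -> cspace R) :
    (0 < l)%N -> (forall j, InClass (X j)) -> InClass (prod_space X)
| in_meas (X : cspace R) (x0 : car X) :
    InClass X -> InClass (meas_space x0).

End Spaces.
Arguments InClass {R}.
Arguments cont {R X}.

(* Main.v *)
(* Each class N(X) is the span of the ridge functions sigma(b + L), where L
   ranges over a vector space V of functions generating the topology of X
   (linear forms, sums of networks on the factors, integrals of networks).

   On the line, the locally uniform closure of the span of the
   x |-> sigma(w x + b) is stable under differences F(x+h) - F(x) of primitives
   F of its members, so it contains the k-th difference tau of a k-th primitive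
   of sigma, a C^k function with k-th derivative the k-th difference of sigma.
   Differentiating tau(w x + b) k times in w at w = 0 puts x^k in the closure,
   unless all k-th differences of sigma vanish, in which case Newton
   interpolation shows that sigma is a polynomial. Hence exp is in the closure,
   as the limit of (1 + x/n)^n. Since the exp(L) are closed under products,
   Stone-Weierstrass gives density on every compact X.

   It remains to see that compactness is inherited. For P(X), an ultrafilter of
   probability measures converges on every continuous f, and the limit is a
   positive functional, represented by a measure through a Daniell outer
   measure. Open sets are measurable for it, being countable unions of cozero
   sets, since countably many functions generate the topology of X. *)
Require Import Defs.
From HB Require Import structures.
From mathcomp Require Import all_boot all_order all_algebra.
From mathcomp Require Import all_classical all_reals all_analysis.
From mathcomp Require Import measurable_realfun ring lra.
Set Implicit Arguments.
Unset Strict Implicit.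
Unset Printing Implicit Defensive.
Import Order.TTheory GRing.Theory Num.Theory.
Import numFieldNormedType.Exports.
Local Open Scope classical_set_scope.
Local Open Scope ring_scope.

(** * Linear spans and calculus on the line *)

(** Adding one generator at a time turns closure properties into plain inductions; [lspanP] recovers
    the finite sums that occur in [nets]. *)
Inductive lspan {R : realType} {T : Type} (G : set (T -> R)) : set (T -> R) :=
| lspan0 : lspan G (fun=> 0)
| lspanS c g h : G g -> lspan G h -> lspan G (fun x => c * g x + h x).

Section LinearSpan.
Context {R : realType} {T : Type}.
Implicit Types (G H : set (T -> R)) (f g h : T -> R).

Lemma lspanD G f g : lspan G f -> lspan G g -> lspan G (fun x => f x + g x).
Proof.
move=> Gf Gg; elim: Gf => [|c f1 f2 Gf1 _ IH].
  by under eq_fun do rewrite add0r.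
by under eq_fun do rewrite -addrA; exact: lspanS.
Qed.

Lemma lspanZ G c f : lspan G f -> lspan G (fun x => c * f x).
Proof.
elim=> [|d f1 f2 Gf1 _ IH].
  by under eq_fun do rewrite mulr0; exact: lspan0.
by under eq_fun do rewrite mulrDr mulrA; exact: lspanS.
Qed.

Lemma lspan_gen G f : G f -> lspan G f.
Proof.
move=> Gf; rewrite (_ : f = fun x => 1 * f x + 0); first exact/lspanS/lspan0.
by apply/funext => x; rewrite mul1r addr0.
Qed.

Lemma lspan_comp {T'} G (G' : set (T' -> R)) (u : T' -> T) f :
  (forall g, G g -> G' (g \o u)) -> lspan G f -> lspan G' (f \o u).
Proof.
move=> GG'; elim=> [|c g h Gg _ IH]; first exact: lspan0.
by apply: (@lspanS _ _ _ c (g \o u)) => //; exact: GG'.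
Qed.

Lemma lspanM G f g :
  (forall f g, G f -> G g -> G (fun x => f x * g x)) ->
  lspan G f -> lspan G g -> lspan G (fun x => f x * g x).
Proof.
move=> GM Gf Gg; elim: Gf => [|c f1 f2 Gf1 _ IH].
  by under eq_fun do rewrite mul0r; exact: lspan0.
under eq_fun do rewrite mulrDl.
apply: lspanD => //; elim: Gg => [|d g1 g2 Gg1 _ IHg].
  by under eq_fun do rewrite mulr0; exact: lspan0.
rewrite (_ : (fun _ => _) = fun x => (c * d) * (f1 x * g1 x) + c * f1 x * g2 x).
  by apply: lspanS => //; exact: GM.
by apply/funext => x; ring.
Qed.

Lemma lspan_ind_closed G (P : set (T -> R)) : P (fun=> 0) ->
  (forall c f g, P f -> P g -> P (fun x => c * f x + g x)) ->
  G `<=` P -> lspan G `<=` P.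
Proof. by move=> P0 PS GP f; elim=> // c g h /GP Pg _ Ph; exact: PS. Qed.

Lemma lspanP G f : lspan G f <->
  exists (n : nat) (c : 'I_n -> R) (g : 'I_n -> T -> R),
    (forall i, G (g i)) /\ f = fun x => \sum_(i < n) c i * g i x.
Proof.
split=> [|[n [c [g [Gg ->]]]]].
  elim=> [|c g h Gg _ [n [d [k [Gk ->]]]]].
    exists 0%N, (fun=> 0), (fun=> fun=> 0); split=> [[]//|].
    by apply/funext => x; rewrite big_ord0.
  exists n.+1, (fun i => if unlift ord0 i is Some j then d j else c),
    (fun i => if unlift ord0 i is Some j then k j else g); split=> [i|].
    by case: unliftP => [j|] _.
  apply/funext => x; rewrite big_ord_recl unlift_none; congr (_ + _).
  by apply: eq_bigr => i _; rewrite liftK.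
elim: n c g Gg => [|n IH] c g Gg.
  by under eq_fun do rewrite big_ord0; exact: lspan0.
under eq_fun do rewrite big_ord_recl.
by apply: lspanS => //; apply: IH => i; exact: Gg.
Qed.

Lemma lspan_sum G n (f : 'I_n -> T -> R) : (forall i, lspan G (f i)) ->
  lspan G (fun x => \sum_(i < n) f i x).
Proof.
elim: n f => [|n IH] f Gf.
  by under eq_fun do rewrite big_ord0; exact: lspan0.
under eq_fun do rewrite big_ord_recl.
by apply: lspanD => //; exact: IH.
Qed.

End LinearSpan.

(** * Mean values, uniform continuity and primitives *)

Section Calculus.
Context {R : realType}.
Implicit Types (f g F : R -> R) (a b d x y z M e : R).

(** The endpoints are unordered because the increments met later, such as [h / n] or [t * x], have
    no fixed sign. *)
Lemma mean_value F f x y :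
  (forall z, Num.min x y <= z <= Num.max x y -> is_derive z 1 F (f z)) ->
  exists2 c, Num.min x y <= c <= Num.max x y & F y - F x = f c * (y - x).
Proof.
move=> dF.
have H (a b : R) : a <= b ->
    (forall z, a <= z <= b -> is_derive z 1 F (f z)) ->
    exists2 c, a <= c <= b & F b - F a = f c * (b - a).
  move=> ab dFab.
  have dab z : z \in `]a, b[%R -> is_derive z 1 F (f z).
    by rewrite in_itv/= => /andP[az zb]; apply: dFab; rewrite !ltW.
  have [|c cab E] := MVT_segment ab dab.
    apply: derivable_within_continuous => z; rewrite in_itv/= => /dFab dFz.
    exact: ex_derive.
  by exists c => //; move: cab; rewrite in_itv.
move: dF; case: (leP x y) => [xy|/ltW yx] dF; first exact: H.
have [c cI E] := H _ _ yx dF; exists c => //; lra.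
Qed.

(** Only [x] is confined to the segment; [y] may leave it. Compactness enters in its near-covering
    form: radii that work around each point yield one radius for all. *)
Lemma unif_cont_segment g M e : continuous g -> 0 < e ->
  exists2 d, 0 < d & forall x y, `|x| <= M -> `|x - y| < d -> `|g x - g y| < e.
Proof.
move=> gc e0.
have cK : compact `[- M, M]%classic by exact: segment_compact.
have H : \forall d \near 0^'+, `[- M, M]%classic `<=`
    (fun x => forall y, `|x - y| < d -> `|g x - g y| < e).
  apply: (proj1 (compact_near_coveringP _) cK) => x _.
  have /cvgrPdist_lt/(_ (e / 2)) := gc x.
  rewrite divr_gt0// => /(_ isT) /nbhs_ballP[r /= r0 xr].
  have r20 : 0 < r / 2 by rewrite divr_gt0.
  exists (ball x (r / 2), [set d | 0 < d < r / 2]) => /=.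
    split; first exact: nbhsx_ballx.
    near=> d => /=; apply/andP; split; near: d.
      exact: nbhs_right_gt.
    exact: nbhs_right_lt.
  move=> [x' d]/= [xx' /andP[d0 dr]] y yx'.
  have h1 := xr x' _.
  have h2 := xr y _.
  rewrite /ball/= in xx' h1 h2.
  have {}h1 : `|g x - g x'| < e / 2 by apply: h1; lra.
  have {}h2 : `|g x - g y| < e / 2.
    apply: h2; rewrite (_ : x - y = (x - x') + (x' - y)); last by ring.
    by rewrite (le_lt_trans (ler_normD _ _))//; lra.
  rewrite (_ : _ - _ = - (g x - g x') + (g x - g y)); last by ring.
  by rewrite (le_lt_trans (ler_normD _ _))// normrN; lra.
have [d [d0 dH]] : exists d, 0 < d /\
    `[- M, M]%classic `<=` (fun x => forall y, `|x - y| < d -> `|g x - g y| < e).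
  have : \forall d \near 0^'+, 0 < d /\
    `[- M, M]%classic `<=` (fun x => forall y, `|x - y| < d -> `|g x - g y| < e).
    near=> d; split; first by near: d; exact: nbhs_right_gt.
    by near: d.
  by move=> /filter_ex.
exists d => // x y xM; apply: dH => /=.
by rewrite in_itv/= -ler_norml.
Unshelve. all: by end_near. Qed.

Lemma primitive_segment g M : continuous g -> 0 < M ->
  exists2 F, F 0 = 0 & forall x, `|x| < M -> is_derive x 1 F (g x).
Proof.
move=> gc M0.
pose F x := parameterized_integral (@lebesgue_measure R) (- M) x g.
exists (fun x => F x - F 0); first by rewrite subrr.
move=> x; rewrite ltr_norml => /andP[xM Mx].
have ig : (@lebesgue_measure R).-integrable `[- M, M]%classic (EFin \o g).
  apply: continuous_compact_integrable; first exact: segment_compact.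
  exact: continuous_subspaceT.
have [dF <-] := continuous_FTC1_closed Mx ig xM (gc x).
have dFx : is_derive x 1 F (derive1 F x).
  by rewrite derive1E; apply: derivableP.
by apply: is_derive_eq; rewrite subr0.
Qed.

(** The primitives vanishing at 0 on the intervals [|x| < n + 1] agree wherever two of them are
    defined, by the mean value theorem for their difference, so they glue. *)
Lemma primitive g : continuous g -> exists F, forall x, is_derive x 1 F (g x).
Proof.
move=> gc.
have /choice[F HF] : forall n : nat, exists F, F 0 = 0 /\
    forall x, `|x| < n.+1%:R -> is_derive x 1 F (g x).
  by move=> n; have [F] := primitive_segment gc (ltr0Sn R n); exists F.
have FE n m x : `|x| < n.+1%:R -> `|x| < m.+1%:R -> F n x = F m x.
  move=> xn xm; have [Fn0 dFn] := HF n; have [Fm0 dFm] := HF m.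
  have [z zI|c _] := mean_value (F := fun z => F n z - F m z) (f := fun=> 0) (x := 0) (y := x).
    have zx : `|z| <= `|x|.
      move: zI; case: (ltrgt0P x) => x0; case: (ltrgt0P z) => z0; lra.
    have d1 := dFn z (le_lt_trans zx xn).
    have d2 := dFm z (le_lt_trans zx xm).
    by apply: is_derive_eq; rewrite subrr.
  by rewrite Fn0 Fm0 mul0r; lra.
pose S x := F (Num.truncn `|x|) x.
exists S => x.
pose n := Num.truncn `|x|.
have xn : `|x| < n.+1%:R by rewrite truncnS_gt.
apply: near_eq_is_derive; last exact: (proj2 (HF n)).
near=> y; apply: FE; last by rewrite truncnS_gt.
near: y; apply: (@cvgr_lt _ _ _ _ (fun y : R => `|y|) `|x|) => //.
exact: cvg_norm.
Unshelve. all: by end_near. Qed.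

End Calculus.

(** * Continuous functions with vanishing finite differences *)

Section FiniteDifferences.
Context {R : realType}.
Implicit Types (f : R -> R) (u : nat -> R) (P Q : {poly R}).

Definition fdiff (h : R) f : R -> R := fun x => f (x + h) - f x.

Let sdiff u : nat -> R := fun n => u n.+1 - u n.

Lemma iter_fdiffS h j f x :
  iter j.+1 (fdiff h) f x = iter j (fdiff h) f (x + h) - iter j (fdiff h) f x.
Proof. by []. Qed.

Let iter_sdiffS j u n :
  iter j.+1 sdiff u n = iter j sdiff u n.+1 - iter j sdiff u n.
Proof. by []. Qed.

(** Newton's forward difference formula. The order drops by one on passing to [sdiff u]; Pascal's
    rule then sums the increments. *)
Lemma newton_forward k u : (forall n, iter k sdiff u n = 0) ->
  forall n, u n = \sum_(j < k) 'C(n, j)%:R * iter j sdiff u 0%N.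
Proof.
elim: k u => [|k IH] u uk n; first by rewrite big_ord0; exact: uk.
have {}IH : forall n, sdiff u n = \sum_(j < k) 'C(n, j)%:R * iter j.+1 sdiff u 0%N.
  move=> i; rewrite IH; last by move=> j; rewrite -iterSr.
  by apply: eq_bigr => j _; rewrite -iterSr.
elim: n => [|n IHn].
  rewrite big_ord_recl bin0 mul1r big1 ?addr0// => i _.
  by rewrite bin0n mul0r.
rewrite (_ : u n.+1 = u n + sdiff u n); last by rewrite /sdiff; ring.
rewrite IHn IH !big_ord_recl !bin0 -addrA -big_split; congr (_ + _).
by apply: eq_bigr => j _; rewrite /= binS natrD mulrDl.
Qed.

(** The polynomial is X (X - 1) ... (X - j + 1) / j!, built from (j + 1) C(n, j + 1) = (n - j) C(n,
    j). *)
Lemma bin_poly (j : nat) : exists P, forall n : nat, P.[n%:R] = 'C(n, j)%:R.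
Proof.
elim: j => [|j [P HP]].
  by exists 1 => n; rewrite hornerC bin0.
exists (j.+1%:R^-1 *: (P * ('X - j%:R%:P))) => n.
rewrite hornerZ hornerM hornerXsubC HP.
apply: (mulfI (x := j.+1%:R)); first by rewrite pnatr_eq0.
rewrite mulVKf ?pnatr_eq0// -natrM mul_bin_left natrM mulrC.
(* For [n < j] the subtraction of natural numbers is truncated, but then the binomial coefficient
   vanishes. *)
case: (leqP j n) => jn; first by rewrite natrB.
by rewrite bin_small// !mulr0.
Qed.

Lemma seq_poly k u : (forall n, iter k sdiff u n = 0) ->
  exists P, forall n : nat, P.[n%:R] = u n.
Proof.
move=> uk.
have /choice[B HB] := bin_poly.
exists (\sum_(j < k) iter j sdiff u 0%N *: B j) => n.
rewrite (newton_forward uk) horner_sum; apply: eq_bigr => j _.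
by rewrite hornerZ HB mulrC.
Qed.

Lemma poly_nat_eq P Q : (forall n : nat, P.[n%:R] = Q.[n%:R]) -> P = Q.
Proof.
move=> PQ; apply/eqP; rewrite -subr_eq0; apply/negPn/negP => D0.
pose s : seq R := [seq n%:R | n <- iota 0 (size (P - Q))].
have := @max_poly_roots _ (P - Q) s D0.
rewrite size_map size_iota ltnn => H; apply: notF; apply: H.
  by apply/allP => _ /mapP[n _ ->]; rewrite rootE !hornerE PQ subrr.
by rewrite map_inj_uniq ?iota_uniq//; exact: mulrIn.
Qed.

(* f agrees on the grid of step 1/m with a polynomial, and all these polynomials
   coincide since they agree on the natural numbers. *)
Lemma fdiff0_poly_nneg f k : continuous f ->
  (forall h x, iter k (fdiff h) f x = 0) ->
  exists P, forall x, 0 <= x -> f x = P.[x].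
Proof.
move=> fc fk.
have grid h : exists P, forall n : nat, P.[n%:R] = f (n%:R * h).
  apply: (@seq_poly k).
  have E j n : iter j sdiff (fun n : nat => f (n%:R * h)) n =
      iter j (fdiff h) f (n%:R * h).
    elim: j n => // j IH n; rewrite iter_sdiffS iter_fdiffS !IH.
    by congr (_ - _); apply: congr1; rewrite -natr1 mulrDl mul1r.
  by move=> n; rewrite E.
have [P HP] := grid 1; exists P.
have PE (m n : nat) : f (n%:R / m.+1%:R) = P.[n%:R / m.+1%:R].
  have [Q HQ] := grid m.+1%:R^-1.
  have -> : P = Q \Po (m.+1%:R *: 'X).
    apply: poly_nat_eq => i; rewrite HP horner_comp !hornerE -natrM HQ natrM.
    by congr f; rewrite mulrAC mulfV ?mul1r ?pnatr_eq0.
  by rewrite horner_comp hornerZ hornerX mulrCA mulfV ?pnatr_eq0// mulr1 HQ.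
move=> x x0; apply/eqP; rewrite -subr_eq0 -normr_le0; apply/ler_addgt0Pl => e e0.
rewrite addr0.
have gc : continuous (fun x => f x - P.[x]).
  by move=> y; apply: continuousB; [exact: fc|exact: continuous_horner].
have /cvgrPdist_lt/(_ _ e0)/nbhs_ballP[r /= r0 xr] := gc x.
have [m mr] : exists m : nat, m.+1%:R^-1 < r.
  exists (Num.truncn r^-1); rewrite -[ltRHS]invrK ltf_pV2 ?posrE ?invr_gt0//.
  by rewrite truncnS_gt.
(* The index of the grid point just below [x], which truncation provides because [x] is
   non-negative. *)
pose n := Num.truncn (x * m.+1%:R).
have /andP[n1 n2] : n%:R <= x * m.+1%:R < n.+1%:R.
  by apply: truncn_itv; rewrite mulr_ge0.
have := xr (n%:R / m.+1%:R); rewrite PE subrr subr0 => H.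
apply/ltW/H; rewrite /ball/=.
have m0 : 0 < m.+1%:R :> R by [].
have le1 : n%:R / m.+1%:R <= x by rewrite ler_pdivrMr.
rewrite ger0_norm ?subr_ge0// (le_lt_trans _ mr)// lerBlDr.
have -> : m.+1%:R^-1 + n%:R / m.+1%:R = n.+1%:R / m.+1%:R :> R.
  by rewrite -[n.+1]add1n natrD mulrDl mul1r.
by rewrite ler_pdivlMr// ltW.
Qed.

(** A negative [x] is reached by translation: y |-> f(y + x) is a polynomial [Q] on the half-line,
    and Q(n - x) = f(n) = P(n) for all natural n, so Q(y) = P(y + x). At y = 0 this gives f(x) =
    P(x). *)
Lemma fdiff0_poly f k : continuous f ->
  (forall h x, iter k (fdiff h) f x = 0) ->
  exists P, forall x, f x = P.[x].
Proof.
move=> fc fk.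
have shiftE j h a x : iter j (fdiff h) (fun x => f (x - a)) x =
    iter j (fdiff h) f (x - a).
  elim: j x => // j IH x; rewrite !iter_fdiffS !IH.
  by congr (_ - _); apply: congr1; ring.
have half (a : R) : exists P, forall x, 0 <= x -> f (x - a) = P.[x].
  apply: (@fdiff0_poly_nneg _ k); last by move=> h x; rewrite shiftE.
  move=> x; apply: continuous_comp; last exact: fc.
  by apply: continuousB; [exact: cvg_id|exact: cvg_cst].
have [P HP] := fdiff0_poly_nneg fc fk; exists P => x.
have [x0|x0] := leP 0 x; first exact: HP.
have [Q HQ] := half (- x).
have PQ : Q = P \Po ('X + x%:P).
  apply/eqP; rewrite -subr_eq0; apply/eqP.
  suff : (Q - (P \Po ('X + x%:P))) \Po ('X - x%:P) = 0.
    move/(congr1 (fun p => p \Po ('X + x%:P))); rewrite -comp_polyA.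
    have -> : ('X - x%:P) \Po ('X + x%:P) = 'X.
      by rewrite comp_polyB comp_polyX comp_polyC addrK.
    by rewrite comp_polyXr => ->; rewrite linear0.
  apply: poly_nat_eq => n; rewrite horner_comp !hornerE horner_comp !hornerE.
  have nx : 0 <= n%:R - x by rewrite subr_ge0 (le_trans (ltW x0)).
  by rewrite -HQ// opprK subrK -HP// subrr.
have := HQ 0 (lexx _); rewrite sub0r opprK => ->.
by rewrite PQ horner_comp !hornerE.
Qed.

End FiniteDifferences.

(** * Ridge functions of one variable *)

Section RidgeClosure.
Context {R : realType} (sigma : R -> R).
Hypothesis sigma_cont : continuous sigma.
Implicit Types (f g F : R -> R) (h w b x y z e M : R).

Definition ridge1 : set (R -> R) :=
  [set g | exists w b, g = fun x => sigma (w * x + b)].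

(** Closure under uniform convergence on bounded sets. It suffices because these functions are later
    composed with forms of bounded range. *)
Definition cridge g := forall M e : R, 0 < e ->
  exists2 h : R -> R, lspan ridge1 h & forall x, `|x| <= M -> `|g x - h x| < e.

Lemma cridge_lim g : (forall M e : R, 0 < e ->
    exists2 h : R -> R, cridge h & forall x, `|x| <= M -> `|g x - h x| < e) -> cridge g.
Proof.
move=> H M e e0; have e20 : 0 < e / 2 by rewrite divr_gt0.
have [h Ch gh] := H M _ e20; have [k Gk hk] := Ch M _ e20.
exists k => // x xM; have := gh x xM; have := hk x xM.
rewrite (_ : g x - k x = (g x - h x) + (h x - k x)); last by ring.
by move=> h1 h2; rewrite (le_lt_trans (ler_normD _ _))//; lra.
Qed.

Lemma cridge_lspan g : lspan ridge1 g -> cridge g.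
Proof. by move=> Gg M e e0; exists g => // x _; rewrite subrr normr0. Qed.

Lemma cridgeS c f g : cridge f -> cridge g -> cridge (fun x => c * f x + g x).
Proof.
move=> Cf Cg M e e0.
(* The added 1 covers [c = 0]. *)
have d0 : 0 < e / 2 / (`|c| + 1) by rewrite !divr_gt0// ltr_wpDl.
have [f' Gf ff'] := Cf M _ d0.
have [g' Gg gg'] := Cg M (e / 2) (divr_gt0 e0 (ltr0Sn _ 1)).
exists (fun x => c * f' x + g' x); first exact/lspanD/Gg/lspanZ.
move=> x xM; have h1 := ff' x xM; have h2 := gg' x xM.
rewrite (_ : _ - _ = c * (f x - f' x) + (g x - g' x)); last by ring.
rewrite (le_lt_trans (ler_normD _ _))// normrM.
have : `|c| * `|f x - f' x| <= e / 2.
  rewrite -[leRHS](@divfK _ (`|c| + 1)) ?gt_eqF ?ltr_wpDl// mulrC.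
  by apply: ler_pM => //; [exact: ltW|rewrite lerDl].
lra.
Qed.

Lemma cridge0 : cridge (fun=> 0).
Proof. exact/cridge_lspan/lspan0. Qed.

Lemma cridgeZ c f : cridge f -> cridge (fun x => c * f x).
Proof.
move=> Cf; have := cridgeS c Cf cridge0.
by under eq_fun do rewrite addr0.
Qed.

Lemma cridge_sum n (f : 'I_n -> R -> R) : (forall i, cridge (f i)) ->
  cridge (fun x => \sum_(i < n) f i x).
Proof.
elim: n f => [|n IH] f Cf.
  by under eq_fun do rewrite big_ord0; exact: cridge0.
under eq_fun do rewrite big_ord_recl -[X in X + _]mul1r.
by apply: cridgeS => //; exact: IH.
Qed.

Lemma cridge_affine g w b : cridge g -> cridge (fun x => g (w * x + b)).
Proof.
move=> Cg M e e0; have [h Gh gh] := Cg (`|w| * M + `|b|) e e0.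
exists (h \o (fun x => w * x + b)).
  apply: lspan_comp Gh => _ [v [c ->]]; exists (v * w), (v * b + c).
  by apply/funext => x /=; rewrite mulrDr mulrA addrA.
move=> x xM; apply: gh; rewrite (le_trans (ler_normD _ _))// lerD2r normrM.
exact: ler_wpM2l.
Qed.

Lemma cridge_sigma : cridge sigma.
Proof.
apply/cridge_lspan/lspan_gen; exists 1, 0.
by apply/funext => x; rewrite mul1r addr0.
Qed.

Lemma between_dist (x y c : R) : Num.min x y <= c <= Num.max x y ->
  `|x - c| <= `|y - x|.
Proof.
case: (leP x y) => xy /andP[]; case: (ger0P (x - c)) => ?;
  case: (ger0P (y - x)) => ? ? ?; lra.
Qed.

(** F(x + h) - F(x) is the limit of the Riemann sums of [f] with mesh h / n, which are combinations
    of translates of [f]. The mean value theorem on each piece and the uniform continuity of [f]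
    bound the error. *)
Lemma cridge_fdiff_primitive f F h : cridge f -> continuous f ->
  (forall x, is_derive x 1 F (f x)) -> cridge (fdiff h F).
Proof.
move=> Cf fc dF; apply: cridge_lim => M e e0.
have d0 : 0 < e / (`|h| + 1) by rewrite divr_gt0// ltr_wpDl.
have [d dgt0 fd] := unif_cont_segment (M + `|h|) fc d0.
pose n := (Num.truncn (`|h| / d)).+1.
have n0 : 0 < n%:R :> R by [].
have nd : `|h| / n%:R < d.
  by rewrite ltr_pdivrMr// mulrC -ltr_pdivrMr// truncnS_gt.
pose p (i : nat) := i%:R * (h / n%:R).
exists (fun x => \sum_(i < n) h / n%:R * f (x + p i)).
  apply: cridge_sum => i; apply: cridgeZ.
  have := cridge_affine 1 (p i) Cf.
  by under eq_fun do rewrite mul1r.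
move=> x xM.
have -> : fdiff h F x = \sum_(i < n) (F (x + p i.+1) - F (x + p i)).
  rewrite -(big_mkord xpredT (fun i => F (x + p i.+1) - F (x + p i))).
  rewrite telescope_sumr// /fdiff /p mul0r addr0; congr (F (x + _) - _).
  by rewrite mulrCA mulfV ?mulr1// gt_eqF.
rewrite -sumrB (le_lt_trans (ler_norm_sum _ _ _))//.
have term (i : 'I_n) : `|F (x + p i.+1) - F (x + p i) - h / n%:R * f (x + p i)| <=
    `|h| / n%:R * (e / (`|h| + 1)).
  have [c cI ->] := @mean_value _ F f (x + p i) (x + p i.+1) (fun z _ => dF z).
  have pS : x + p i.+1 - (x + p i) = h / n%:R.
    by rewrite /p -natr1 mulrDl mul1r; ring.
  rewrite pS mulrC -mulrBr normrM normrM normfV normr_nat distrC ler_wpM2l//.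
  apply/ltW/fd.
    rewrite (le_trans (ler_normD _ _))// lerD//.
    rewrite /p !normrM normfV !normr_nat mulrCA ler_piMr// ler_pdivrMr// mul1r.
    by rewrite ler_nat ltnW.
  rewrite (le_lt_trans (between_dist cI))// pS normrM normfV normr_nat.
  exact: nd.
rewrite (le_lt_trans (ler_sum _ (fun i _ => term i)))// sumr_const card_ord.
have h1 : 0 < `|h| + 1 by rewrite ltr_wpDl.
rewrite -[ltLHS]mulr_natl mulrA [n%:R * _]mulrC divfK ?gt_eqF// mulrCA gtr_pMr//.
by rewrite ltr_pdivrMr ?ltr_wpDl// mul1r ltrDl.
Qed.

(** Differentiation in the weight [w]: the difference quotients of x^j f(w x + b) converge locally
    uniformly to x^(j+1) f'(w x + b). *)
Lemma cridge_derive j f f' : (forall w b, cridge (fun x => x ^+ j * f (w * x + b))) ->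
  continuous f' -> (forall x, is_derive x 1 f (f' x)) ->
  forall w b, cridge (fun x => x ^+ j.+1 * f' (w * x + b)).
Proof.
move=> Cf fc df w b; apply: cridge_lim => M e e0.
pose M' := `|M| + 1.
have M'0 : 0 < M' by rewrite ltr_wpDl.
have d0 : 0 < e / M' ^+ j.+1 by rewrite divr_gt0// exprn_gt0.
have [d dgt0 fd] := unif_cont_segment (`|w| * M' + `|b|) fc d0.
(* With this increment the arguments at weights [w] and [w + t] differ by less than [d] as long as
   [|x| <= M']. *)
pose t := d / M' / 2.
have t0 : 0 < t by rewrite !divr_gt0.
exists (fun x => t^-1 * (x ^+ j * f ((w + t) * x + b)) +
    (- t^-1 * (x ^+ j * f (w * x + b)))).
  by apply: cridgeS => //; apply: cridgeZ.
move=> x xM.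
have xM' : `|x| < M' by rewrite (le_lt_trans xM)// (le_lt_trans (ler_norm _))// ltrDl.
have [c cI fE] := @mean_value _ f f' (w * x + b) ((w + t) * x + b) (fun z _ => df z).
have E : (w + t) * x + b - (w * x + b) = t * x by ring.
rewrite [X in _ - X](_ : _ = x ^+ j.+1 * f' c); last first.
  rewrite mulNr -mulrBr -mulrBr fE E exprSr.
  by field; rewrite gt_eqF.
rewrite -mulrBr normrM normrX.
have lt1 : `|f' (w * x + b) - f' c| < e / M' ^+ j.+1.
  apply: fd; first by rewrite (le_trans (ler_normD _ _))// lerD2r normrM ler_wpM2l// ltW.
  rewrite (le_lt_trans (between_dist cI))// E normrM gtr0_norm//.
  rewrite (@lt_trans _ _ (t * M')) ?ltr_pM2l// /t mulrAC divfK ?gt_eqF//.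
  by lra.
rewrite (@le_lt_trans _ _ (M' ^+ j.+1 * `|f' (w * x + b) - f' c|))//.
  by apply: ler_wpM2r => //; rewrite lerXn2r ?nnegrE// ltW.
by rewrite mulrC -ltr_pdivlMr// exprn_gt0.
Qed.

Hypothesis sigma_not_poly : ~ exists P : {poly R}, forall x, sigma x = P.[x].

Lemma cridgeX k : cridge (fun x => x ^+ k).
Proof.
(* Choice needs a total operator, so the property of being a primitive is only promised for
   continuous [g]. *)
have /choice[prim Hprim] : forall g, exists F, continuous g ->
    forall x, is_derive x 1 F (g x).
  move=> g; have [gc|gc] := pselect (continuous g); last by exists g.
  by have [F HF] := primitive gc; exists F.
pose S n := iter n prim sigma.
have Sc n : continuous (S n).
  elim: n => // n IH x; apply: differentiable_continuous.
  by apply/derivable1_diffP; apply: ex_derive; exact: Hprim.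
have dS n x : is_derive x 1 (S n.+1) (S n x) by exact: Hprim.
have contD h n f : continuous f -> continuous (iter n (fdiff h) f).
  move=> fc; elim: n => // n IH x.
  have c1 : {for x, continuous (fun x => iter n (fdiff h) f (x + h))}.
    apply: continuous_comp; last exact: IH.
    by apply: continuousD; [exact: cvg_id|exact: cvg_cst].
  exact: continuousB c1 (IH x).
have derD h n f f' : (forall x, is_derive x 1 f (f' x)) ->
    forall x, is_derive x 1 (iter n (fdiff h) f) (iter n (fdiff h) f' x).
  move=> df; elim: n => // n IH x.
  have d1 : is_derive x 1 (fun x => iter n (fdiff h) f (x + h))
      (iter n (fdiff h) f' (x + h)).
    have := @is_derive1_comp _ (iter n (fdiff h) f) (fun x => x + h) x
      (iter n (fdiff h) f' (x + h)) 1 (IH _) (is_derive_shift x 1 h).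
    by rewrite mulr1.
  exact: is_deriveB d1 (IH x).
have CS h n : cridge (iter n (fdiff h) (S n)).
  elim: n => [|n IH]; first exact: cridge_sigma.
  rewrite iterS; apply: (@cridge_fdiff_primitive (iter n (fdiff h) (S n))) => //.
  by apply: contD; exact: Sc.
(* Starting from the k-th difference of [S k], each differentiation in the weight trades one
   primitive for one power of x; at [j = k] only [sigma] is left. *)
have Cj h j i : (j + i = k)%N -> forall w b,
    cridge (fun x => x ^+ j * iter k (fdiff h) (S i) (w * x + b)).
  elim: j i => [|j IH] i.
    rewrite add0n => -> w b; under eq_fun do rewrite mul1r.
    exact: (cridge_affine w b (CS h k)).
  rewrite addSnnS => jik; apply: (cridge_derive (IH _ jik)).
  by apply: contD; exact: Sc.
have [h [b nz]] : exists h b, iter k (fdiff h) sigma b != 0.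
  apply: contrapT => /forallNP nz; apply: sigma_not_poly.
  apply: (@fdiff0_poly _ _ k) => // h x; apply: contrapT => /eqP H.
  by apply: (nz h); exists x.
(* At weight 0 the second factor is the nonzero constant found above, and dividing by it leaves
   x^k. *)
have := cridgeZ (iter k (fdiff h) sigma b)^-1 (Cj h k 0%N (addn0 k) 0 b).
congr cridge; apply/funext => x.
by rewrite mul0r add0r mulrC mulfK.
Qed.

(* (1 + x/n)^n is within a factor 1 - x^2/n of exp x, because
   (1 - y^2) exp y <= 1 + y <= exp y for |y| < 1. *)
Lemma cridge_expR : cridge expR.
Proof.
apply: cridge_lim => M e e0.
(* [n > K] brings the error bound e^|M| M^2 / n below [e], and [n > |M|] gives |x / n| < 1. *)
pose K := expR `|M| * M ^+ 2 / e.
pose n := (maxn (Num.truncn K) (Num.truncn `|M|)).+1.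
have n0 : 0 < n%:R :> R by [].
have nK : K < n%:R.
  by rewrite (lt_le_trans (truncnS_gt _))// ler_nat ltnS leq_maxl.
have nM : `|M| < n%:R.
  by rewrite (lt_le_trans (truncnS_gt _))// ler_nat ltnS leq_maxr.
exists (fun x => (n%:R^-1 * x + 1) ^+ n).
  by apply: (cridge_affine _ _ (cridgeX n)).
move=> x xM.
have xM' : `|x| <= `|M| by rewrite (le_trans xM)// ler_norm.
pose y := n%:R^-1 * x; rewrite -/y.
have ny : n%:R * y = x by rewrite /y mulVKf// gt_eqF.
have y1 : `|y| < 1.
  by rewrite normrM normfV normr_nat mulrC ltr_pdivrMr// mul1r (le_lt_trans xM').
have /andP[yN1 yl1] : -1 < y < 1 by rewrite -ltr_norml.
have up : (y + 1) ^+ n <= expR x.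
  rewrite -ny expRM_natl lerXn2r ?nnegrE ?expR_ge0//; first by lra.
  by rewrite addrC expR_ge1Dx.
have lo : expR x * (1 - n%:R * y ^+ 2) <= (y + 1) ^+ n.
  have lo1 : expR y * (1 - y ^+ 2) <= y + 1.
    have := expR_ge1Dx (- y); rewrite expRN => H.
    have e0' := expR_gt0 y.
    rewrite (_ : 1 - y ^+ 2 = (1 - y) * (y + 1)); last by ring.
    rewrite mulrA ler_piMl//; first by lra.
    by rewrite -ler_pdivlMl// mulr1.
  have y2 : 0 <= y ^+ 2 <= 1.
    rewrite sqr_ge0 -[leRHS](expr1n _ 2) -[leLHS](real_normK (num_real _)).
    by rewrite lerXn2r// ?nnegrE// ltW.
  (* Bernoulli's inequality, which turns the factor (1 - y^2)^n into 1 - n y^2 = 1 - x^2 / n. *)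
  have bern m : 1 - m%:R * y ^+ 2 <= (1 - y ^+ 2) ^+ m.
    elim: m => [|m IH]; first by rewrite mul0r subr0.
    rewrite [leRHS]exprS (@le_trans _ _ ((1 - y ^+ 2) * (1 - m%:R * y ^+ 2)))//.
      have : 0 <= m%:R * (y ^+ 2 * y ^+ 2) by rewrite mulr_ge0// mulr_ge0// sqr_ge0.
      by rewrite -natr1; lra.
    by apply: ler_wpM2l => //; lra.
  rewrite (@le_trans _ _ (expR x * (1 - y ^+ 2) ^+ n))//.
    by rewrite ler_wpM2l ?expR_ge0.
  rewrite -ny expRM_natl -exprMn lerXn2r ?nnegrE//; last by lra.
  by rewrite mulr_ge0 ?expR_ge0//; lra.
rewrite ger0_norm ?subr_ge0//.
have : expR x - (y + 1) ^+ n <= expR x * (n%:R * y ^+ 2) by lra.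
move=> /le_lt_trans; apply.
have -> : n%:R * y ^+ 2 = x ^+ 2 / n%:R.
  by rewrite (expr2 y) mulrA ny /y mulrCA -expr2 mulrC.
rewrite mulrA ltr_pdivrMr// (le_lt_trans (y := expR `|M| * M ^+ 2))//.
  apply: ler_pM; rewrite ?expR_ge0 ?sqr_ge0//.
    by rewrite ler_expR (le_trans (ler_norm _)).
  by rewrite -[M ^+ 2](real_normK (num_real _)) -[x ^+ 2](real_normK (num_real _)) lerXn2r ?nnegrE.
by rewrite [ltRHS]mulrC -ltr_pdivrMr.
Qed.

End RidgeClosure.

(** * The Stone-Weierstrass theorem *)

Section UniformClosure.
Context {R : realType} {T : Type}.
Implicit Types (A B : set (T -> R)) (f g h : T -> R) (c e M : R).

(** Closure for the supremum distance. [T] is a bare type, so that the notion applies to the carrier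
    of a space whatever topology is put on it. *)
Definition ucl A f := forall e, 0 < e -> exists2 g, A g & forall x, `|f x - g x| < e.

Lemma sub_ucl A : A `<=` ucl A.
Proof. by move=> f Af e e0; exists f => // x; rewrite subrr normr0. Qed.

Lemma ucl_idem A : ucl (ucl A) `<=` ucl A.
Proof.
move=> f Af e e0; have e20 : 0 < e / 2 by rewrite divr_gt0.
have [g Ag fg] := Af _ e20; have [h Ah gh] := Ag _ e20.
exists h => // x; have := fg x; have := gh x.
rewrite (_ : f x - h x = (f x - g x) + (g x - h x)); last by ring.
by move=> h1 h2; rewrite (le_lt_trans (ler_normD _ _))//; lra.
Qed.

Lemma uclS A B : A `<=` B -> ucl A `<=` ucl B.
Proof. by move=> AB f Af e /Af[g /AB]; exists g. Qed.

Definition lin_closed A := A (fun=> 0) /\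
  forall c f g, A f -> A g -> A (fun x => c * f x + g x).

Definition bounded_fun f := exists2 M : R, 0 < M & forall x, `|f x| <= M.

Definition mul_closed A := forall f g, A f -> A g -> A (fun x => f x * g x).

Lemma lin_closed_lspan A : lin_closed (lspan A).
Proof.
split=> [|c f g Af Ag]; first exact: lspan0.
exact/lspanD/Ag/lspanZ.
Qed.

Lemma lin_closedD A f g : lin_closed A -> A f -> A g -> A (fun x => f x + g x).
Proof.
move=> [_ AS] Af Ag; have := AS 1 f g Af Ag.
by under eq_fun do rewrite mul1r.
Qed.

Lemma lin_closedZ A c f : lin_closed A -> A f -> A (fun x => c * f x).
Proof.
move=> [A0 AS] Af; have := AS c f _ Af A0.
by under eq_fun do rewrite addr0.
Qed.

Lemma lin_closed_sum A n (f : 'I_n -> T -> R) : lin_closed A ->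
  (forall i, A (f i)) -> A (fun x => \sum_(i < n) f i x).
Proof.
move=> Al; elim: n f => [|n IH] f Af.
  by under eq_fun do rewrite big_ord0; case: Al.
under eq_fun do rewrite big_ord_recl.
by apply: lin_closedD => //; exact: IH.
Qed.

Lemma lin_closed_ucl A : lin_closed A -> lin_closed (ucl A).
Proof.
move=> [A0 AS]; split=> [|c f g Af Ag e e0]; first exact: sub_ucl.
have d0 : 0 < e / 2 / (`|c| + 1) by rewrite !divr_gt0// ltr_wpDl.
have [f' Af' ff'] := Af _ d0.
have [g' Ag' gg'] := Ag (e / 2) (divr_gt0 e0 (ltr0Sn _ 1)).
exists (fun x => c * f' x + g' x); first exact: AS.
move=> x; have h1 := ff' x; have h2 := gg' x.
rewrite (_ : _ - _ = c * (f x - f' x) + (g x - g' x)); last by ring.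
rewrite (le_lt_trans (ler_normD _ _))// normrM.
have : `|c| * `|f x - f' x| <= e / 2.
  rewrite -[leRHS](@divfK _ (`|c| + 1)) ?gt_eqF ?ltr_wpDl// mulrC.
  by apply: ler_pM => //; [exact: ltW|rewrite lerDl].
lra.
Qed.

Lemma bounded_ucl A f : A `<=` bounded_fun -> ucl A f -> bounded_fun f.
Proof.
move=> bA /(_ 1 ltr01)[g /bA[M M0 gM] fg]; exists (M + 1); first by lra.
move=> x; have := gM x; have := fg x.
rewrite -[X in _ -> _ -> `|X| <= _](subrK (g x)) => h1 h2.
by rewrite (le_trans (ler_normD _ _))//; lra.
Qed.

Lemma bounded_lspan A : A `<=` bounded_fun -> lspan A `<=` bounded_fun.
Proof.
move=> bA; apply: lspan_ind_closed => //.
  by exists 1 => // x; rewrite normr0.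
move=> c f g [M M0 fM] [N N0 gN]; exists (`|c| * M + N).
  by rewrite ltr_wpDl// mulr_ge0// ltW.
move=> x; rewrite (le_trans (ler_normD _ _))// lerD// normrM.
by rewrite ler_wpM2l.
Qed.

Lemma mul_closed_ucl A : A `<=` bounded_fun -> mul_closed A -> mul_closed (ucl A).
Proof.
move=> bA AM f g Af Ag e e0.
(* The order matters: [g'] is chosen against a bound of [f], and then [f'] against a bound of
   [g']. *)
have [M M0 fM] := bounded_ucl bA Af.
have d0 : 0 < e / 2 / M by rewrite !divr_gt0.
have [g' Ag' gg'] := Ag _ d0.
have [N N0 gN] := bA _ Ag'.
have d1 : 0 < e / 2 / N by rewrite !divr_gt0.
have [f' Af' ff'] := Af _ d1.
exists (fun x => f' x * g' x); first exact: AM.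
move=> x.
rewrite (_ : _ - _ = f x * (g x - g' x) + (f x - f' x) * g' x); last by ring.
rewrite (le_lt_trans (ler_normD _ _))// !normrM.
have h1 : `|f x| * `|g x - g' x| <= M * `|g x - g' x| by rewrite ler_wpM2r.
have h2 : `|f x - f' x| * `|g' x| <= `|f x - f' x| * N by rewrite ler_wpM2l.
have h3 : M * `|g x - g' x| < e / 2 by rewrite mulrC -ltr_pdivlMr.
have h4 : `|f x - f' x| * N < e / 2 by rewrite -ltr_pdivlMr.
lra.
Qed.

End UniformClosure.

Lemma lin_closed_continuous_at {R : realType} {T : topologicalType} (x : T) :
  lin_closed [set f : T -> R | {for x, continuous f}].
Proof.
split=> [|c f g fc gc]; first exact: cvg_cst.
by apply: cvgD => //; apply: cvgM => //; exact: cvg_cst.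
Qed.

Section StoneWeierstrass.
Context {R : realType} {T : topologicalType}.
Hypothesis Tcompact : compact [set: T].
Implicit Types (f g h : T -> R) (x y : T).

(** If no finite family covered, the complements of the finite unions would generate a proper
    filter, and a cluster point [p] of it would contradict [U p]. *)
Lemma compact_seq_cover (U : T -> set T) : (forall x, nbhs x (U x)) ->
  exists s : seq T, forall y, exists2 x, x \in s & U x y.
Proof.
move=> nU; apply: contrapT => /forallNP H.
pose F := filter_from [set: seq T] (fun s => [set y | forall x, x \in s -> ~ U x y]).
have FF : ProperFilter F.
  apply: filter_from_proper.
    apply: filter_from_filter; first by exists [::].
    move=> s t _ _; exists (s ++ t) => // y /= Hy; split=> x xs; apply: Hy;
      by rewrite mem_cat xs ?orbT.
  move=> s _; have /existsNP[y Hy] := H s; exists y => x xs Uxy.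
  by apply: Hy; exists x.
have [p [_ clp]] := Tcompact FF filterT.
have Fp : F [set y | ~ U p y].
  by exists [:: p] => // y /= Hy; apply: Hy; rewrite inE.
by have [y [/=]] := clp _ _ Fp (nU p).
Qed.

Lemma continuous_bounded f : continuous f -> bounded_fun f.
Proof.
move=> fc.
have [x|s Hs] := @compact_seq_cover (fun x => [set y | `|f x - f y| < 1]).
  by move: (fc x) => /cvgrPdist_lt; exact.
pose M := \sum_(x <- s) `|f x|; exists (M + 1).
  by rewrite ltr_wpDl// sumr_ge0.
move=> y; have [x xs /= xy] := Hs y.
have fM : `|f x| <= M by rewrite /M (big_rem x)//= lerDl sumr_ge0.
rewrite (_ : f y = f x - (f x - f y)); last by ring.
by rewrite (le_trans (ler_normB _ _))//; lra.
Qed.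

Variable B : set (T -> R).
Hypothesis B1 : B (fun=> 1).
Hypothesis Blin : lin_closed B.
Hypothesis Bmul : mul_closed B.
Hypothesis Bucl : ucl B `<=` B.
Hypothesis Bbnd : B `<=` bounded_fun.

Let BD f g : B f -> B g -> B (fun x => f x + g x).
Proof. exact: lin_closedD. Qed.

Let BZ c f : B f -> B (fun x => c * f x).
Proof. exact: lin_closedZ. Qed.

Let Bcst c : B (fun=> c).
Proof. by have := BZ c B1; under eq_fun do rewrite mulr1. Qed.

(* |f| is the uniform limit of q_0 = 0, q_(n+1) = q_n + (f^2 - q_n^2) / 2. *)
Lemma alg_norm f : B f -> B (fun x => `|f x|).
Proof.
move=> Bf; have [M M0 fM] := Bbnd Bf.
pose g x := M^-1 * f x.
have Bg : B g by exact: BZ.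
have g1 x : `|g x| <= 1.
  by rewrite /g normrM normfV (gtr0_norm M0) mulrC ler_pdivrMr// mul1r.
have -> : (fun x => `|f x|) = (fun x => M * `|g x|).
  apply/funext => x; rewrite /g normrM normfV (gtr0_norm M0).
  by rewrite mulVKf// gt_eqF.
apply: BZ; apply: Bucl => e e0.
pose q n := iter n (fun h x => h x + 2^-1 * (g x * g x + (- 1) * (h x * h x))) (fun=> 0).
have qS n x : q n.+1 x = q n x + 2^-1 * (g x * g x + (- 1) * (q n x * q n x)) by [].
have Bq n : B (q n).
  elim: n => [|n IH]; first exact: Bcst.
  by apply: BD => //; apply: BZ; apply: BD; [|apply: BZ]; exact: Bmul.
pose n := Num.truncn (2 / e).
exists (q n) => // x.
(* The second bound gives an error below 2 / m for m > 0, uniformly in [x], including near the zeros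
   of [g]. *)
have key m : 0 <= q m x <= `|g x| /\ (`|g x| - q m x) * (1 + m%:R * (`|g x| / 2)) <= `|g x|.
  have gx := g1 x; have a0 : 0 <= `|g x| by [].
  have gg : g x * g x = `|g x| * `|g x| by rewrite -normrM ger0_norm// sqr_ge0.
  elim: m => [|m [/andP[q0 qg] IH]].
    by rewrite lexx a0 mul0r addr0 mulr1 subr0.
  rewrite qS gg; set a := `|g x| in a0 gx q0 qg IH *; set p := q m x in q0 qg IH *.
  have E : a - (p + 2^-1 * (a * a + -1 * (p * p))) = (a - p) * (1 - (a + p) / 2) by field.
  have s1 : 0 <= (a - p) * (1 - (a + p) / 2) by rewrite mulr_ge0//; lra.
  have s2 : 0 <= 2^-1 * (a * a + -1 * (p * p)).
    by rewrite (_ : _ * _ = 2^-1 * ((a - p) * (a + p))); [rewrite !mulr_ge0//; lra|ring].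
  split; first by apply/andP; split; lra.
  rewrite E -[m.+1%:R]natr1.
  have m0 : 0 <= m%:R :> R by [].
  set k := m%:R in m0 IH *.
  apply: le_trans IH; rewrite -mulrA; apply: ler_wpM2l; first by lra.
  have h1 : 0 <= a / 2 * (a / 2) * k by rewrite !mulr_ge0//; lra.
  have h2 : 0 <= p / 2 * (1 + (k + 1) * (a / 2)) by rewrite !mulr_ge0 ?addr_ge0 ?mulr_ge0//; lra.
  have h3 : 0 <= (a / 2) * (a / 2) by rewrite mulr_ge0//; lra.
  lra.
have [/andP[q0 qg] H] := key n.
rewrite ger0_norm ?subr_ge0//.
have gx := g1 x; have a0 : 0 <= `|g x| by [].
have n1 : 2 / e < n%:R + 1 by rewrite natr1 truncnS_gt.
have n2 : 2 < (n%:R + 1) * e by rewrite -ltr_pdivrMr.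
set a := `|g x| in gx a0 q0 qg H *.
rewrite ltNge; apply/negP => le1.
have n0 : 0 <= n%:R :> R by [].
have : e * (1 + n%:R * (a / 2)) <= a.
  apply: le_trans H; apply: ler_wpM2r => //.
  by rewrite addr_ge0// mulr_ge0//; lra.
move=> le2.
have : 2 * a <= (n%:R + 1) * e * a by rewrite ler_wpM2r// ltW.
have : 0 <= e * (2 - a) by rewrite mulr_ge0//; lra.
nra.
Qed.

Lemma alg_min f g : B f -> B g -> B (fun x => Num.min (f x) (g x)).
Proof.
move=> Bf Bg.
have -> : (fun x => Num.min (f x) (g x)) =
    fun x => 2^-1 * ((f x + g x) + (-1) * `|f x + (-1) * g x|).
  apply/funext => x; case: (leP (f x) (g x)) => fg.
    by rewrite ler0_norm; [field|lra].
  by rewrite gtr0_norm; [field|lra].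
apply: BZ; apply: BD; first exact: BD.
by apply: BZ; apply: alg_norm; apply: BD => //; exact: BZ.
Qed.

(** This takes the place of separation of points: [d] vanishes at [x] and is at least [r] off
    [U]. *)
Hypothesis bump : forall x U, nbhs x U -> exists d (r : R),
  [/\ B d, {for x, continuous d}, (forall y, 0 <= d y) & d x = 0] /\
  0 < r /\ forall y, d y < r -> U y.

(* A continuous f lies below each f(x) + e + M_x d_x, which is close to f near
   x, so a finite minimum of such functions approximates f. *)
Lemma stone_weierstrass f : continuous f -> B f.
Proof.
move=> fc; apply: Bucl => e0 e00.
pose e := e0 / 4; have e_gt0 : 0 < e by rewrite divr_gt0.
have [K K0 fK] := continuous_bounded fc.
have nf x : nbhs x [set y | `|f x - f y| < e].
  by move: (fc x) => /cvgrPdist_lt; exact.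
have /choice[h Hh] : forall x, exists h, [/\ B h, (forall y, f y < h y) &
    nbhs x [set y | h y < f y + e0]].
  move=> x; have [d [r [[Bd dc d0 dx0] [r0 dr]]]] := bump (nf x).
  (* Off the neighbourhood [d] is at least [r], so the slope 2 K / r adds at least 2 K there and
     lifts [h] above the bound [K] of [f]. *)
  have M0 : 0 <= 2 * K / r by rewrite divr_ge0 ?mulr_ge0// ltW.
  exists (fun y => (f x + e) + (2 * K / r) * d y); split.
  - by apply: BD; [exact: Bcst|exact: BZ].
  - move=> y; have [/dr /= |rd] := ltP (d y) r.
      have := mulr_ge0 M0 (d0 y); rewrite ltr_norml => ? /andP[? ?]; lra.
    have : 2 * K <= 2 * K / r * d y.
      rewrite -mulrA ler_peMr//; first by lra.
      by rewrite mulrC ler_pdivlMr// mul1r.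
    have := fK x; have := fK y; rewrite !ler_norml => /andP[? ?] /andP[? ?]; lra.
  - have M1 : 0 < 2 * K / r + 1 by lra.
    have eM : 0 < e / (2 * K / r + 1) by rewrite divr_gt0.
    have nd : nbhs x [set y | `|d x - d y| < e / (2 * K / r + 1)].
      by move: dc => /cvgrPdist_lt; exact.
    apply: filterS2 nd (nf x) => y /=.
    rewrite dx0 sub0r normrN (ger0_norm (d0 y)) ltr_pdivlMr// ltr_norml.
    have := mulr_ge0 M0 (d0 y); have := d0 y.
    rewrite /e => ? ? ? /andP[? ?]; lra.
have [x|s Hs] := @compact_seq_cover (fun x => [set y | h x y < f y + e0]).
  by case: (Hh x).
have [m [Bm fm mh]] : exists m, [/\ B m, (forall y, f y <= m y) &
    forall x, x \in s -> forall y, m y <= h x y].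
  elim: s {Hs} => [|x s [m [Bm fm mh]]].
    (* The constant [K] serves as the minimum over the empty list. *)
    exists (fun=> K); split=> // y.
    by rewrite (le_trans (ler_norm _)).
  have [Bh fh _] := Hh x.
  exists (fun y => Num.min (h x y) (m y)); split; first exact: alg_min.
    by move=> y; rewrite le_min fm ltW.
  move=> z; rewrite inE => /predU1P[->|zs] y; first by rewrite ge_min lexx.
  by rewrite ge_min mh// orbT.
exists m => // y; have [x xs /= hxy] := Hs y.
have := fm y; have := mh x xs y => ? ?.
by rewrite ler0_norm; lra.
Qed.

End StoneWeierstrass.

(** * Stone-Weierstrass for a topology generated by functions *)

Section GeneratedAlgebra.
Context {R : realType} {T : topologicalType}.

(** One half of the statement that [V] induces the topology; the other half is the continuity of its
    members, assumed separately as [Vcont]. *)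
Definition generates (V : set (T -> R)) := forall x U, nbhs x U ->
  exists (k : nat) (L : 'I_k -> T -> R) (r : R),
  [/\ (forall i, V (L i)), 0 < r &
      forall y, (forall i, `|L i y - L i x| < r) -> U y].

Variables (G V : set (T -> R)).
Hypothesis Tcompact : compact [set: T].
Hypothesis G1 : G (fun=> 1).
Hypothesis Gmul : mul_closed G.
Hypothesis Gbnd : G `<=` bounded_fun.
Hypothesis VG : V `<=` ucl (lspan G).
Hypothesis Vcont : forall L, V L -> continuous L.
Hypothesis Vgen : generates V.

(** The closure of the span of [G] is a closed algebra containing [V], hence also the sums of the
    |L_i - L_i(x)|, which serve as bumps at [x]. *)
Theorem stone_weierstrass_gen f : continuous f -> ucl (lspan G) f.
Proof.
have Glin := lin_closed_ucl (lin_closed_lspan G).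
have lGbnd := bounded_lspan Gbnd.
have Bbnd : ucl (lspan G) `<=` bounded_fun by move=> g; exact: bounded_ucl.
have BU : ucl (ucl (lspan G)) `<=` ucl (lspan G) by exact: ucl_idem.
have lGmul : mul_closed (lspan G) by move=> g h; exact: lspanM.
have Bmul := mul_closed_ucl lGbnd lGmul.
have B1 : ucl (lspan G) (fun=> 1) by exact/sub_ucl/lspan_gen.
move=> fc; apply: (stone_weierstrass Tcompact B1 Glin Bmul BU Bbnd) fc => x U.
move=> /Vgen[k [L [r [VL r0 LU]]]].
exists (fun y => \sum_(i < k) `|L i y + - L i x|), r; split; first split.
- apply: lin_closed_sum => // i; apply: (alg_norm B1 Glin Bmul BU Bbnd).
  apply: (lin_closedD Glin); first exact: VG.
  have := lin_closedZ (- L i x) Glin B1.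
  by under eq_fun do rewrite mulr1.
- apply: (lin_closed_sum (lin_closed_continuous_at x)) => i /=.
  apply: cvg_norm; apply: cvgD; last exact: cvg_cst.
  exact: (Vcont (VL i)).
- by move=> y; rewrite sumr_ge0.
- by rewrite big1// => i _; rewrite subrr normr0.
- split=> // y yr; apply: LU => i; apply: le_lt_trans yr.
  by rewrite (bigD1 i)//= lerDl sumr_ge0.
Qed.

End GeneratedAlgebra.

(** * Density of ridge functions over a generating vector space *)

Section RidgeDensity.
Context {R : realType} (sigma : R -> R).
Hypothesis sigma_cont : continuous sigma.
Hypothesis sigma_not_poly : ~ exists P : {poly R}, forall x, sigma x = P.[x].

Definition ridge {T : Type} (V : set (T -> R)) : set (T -> R) :=
  [set g | exists L b, V L /\ g = fun x => sigma (b + L x)].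

(** The range of [L] lies in a segment, where the approximation of [f] is uniform, and [w * L] stays
    in [V], so ridge functions on the line become ridge functions over [V]. *)
Lemma cridge_ucl (T : Type) (V : set (T -> R)) (f : R -> R) L :
  lin_closed V -> V L -> bounded_fun L -> cridge sigma f ->
  ucl (lspan (ridge V)) (f \o L).
Proof.
move=> Vl VL [M M0 LM] Cf e e0; have [g Gg fg] := Cf M e e0.
exists (g \o L) => [|x]; last exact: fg.
apply: lspan_comp Gg => _ [w [b ->]]; exists (fun x => w * L x), b; split.
  exact: lin_closedZ.
by apply/funext => x; rewrite /= addrC.
Qed.

(** From e^x (1 - x) <= 1 follows (e^x - 1 - x)(1 - x) <= x^2, and 1 - x >= 1/2. *)
Lemma expR_lin (x : R) : `|x| <= 2^-1 -> `|expR x - 1 - x| <= 2 * x ^+ 2.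
Proof.
move=> /[dup] x1; rewrite ler_norml => /andP[xl xr].
have lo : 0 <= expR x - 1 - x by have := expR_ge1Dx x; lra.
rewrite ger0_norm//.
have : expR x * (1 - x) <= 1.
  have := expR_ge1Dx (- x); rewrite expRN => H.
  by rewrite mulrC -ler_pdivlMr ?expR_gt0// mul1r.
have e0 := expR_gt0 x.
have x20 : 0 <= x ^+ 2 by exact: sqr_ge0.
have h : 0 <= (expR x - 1 - x) * (1 / 2 - x) by rewrite mulr_ge0//; lra.
rewrite expr2 in x20 *; nra.
Qed.

Variables (T : topologicalType) (V : set (T -> R)).
Hypothesis Tcompact : compact [set: T].
Hypothesis Vlin : lin_closed V.
Hypothesis Vcont : forall L, V L -> continuous L.
Hypothesis Vgen : generates V.

Let E : set (T -> R) := [set g | exists2 L, V L & g = expR \o L].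

Let Ebnd : E `<=` bounded_fun.
Proof.
move=> _ [L VL ->]; have [M M0 LM] := continuous_bounded Tcompact (Vcont VL).
exists (expR M); first exact: expR_gt0.
move=> x /=; rewrite gtr0_norm ?expR_gt0// ler_expR.
by rewrite (le_trans (ler_norm _)).
Qed.

Let EM : mul_closed E.
Proof.
move=> _ _ [L VL ->] [L' VL' ->].
exists (fun x => L x + L' x); first exact: lin_closedD.
by apply/funext => x; rewrite /= expRD.
Qed.

Let E1 : E (fun=> 1).
Proof.
exists (fun=> 0); first by case: Vlin.
by apply/funext => x; rewrite /= expR0.
Qed.

(** (e^(t L) - 1) / t tends to [L] uniformly as t tends to 0. *)
Let EV L : V L -> ucl (lspan E) L.
Proof.
move=> VL e e0; have [M M0 LM] := continuous_bounded Tcompact (Vcont VL).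
(* The first bound keeps |t L| <= 1/2, as [expR_lin] requires; the second keeps the error 2 t M^2 at
   most e / 2. *)
pose t := Num.min ((2 * M)^-1) (e / (4 * M ^+ 2)).
have t0 : 0 < t by rewrite lt_min invr_gt0 divr_gt0 ?mulr_gt0 ?exprn_gt0.
have t1 : t * M <= 2^-1.
  rewrite -ler_pdivlMr// -invfM; by rewrite ge_min lexx.
have t2 : t * M ^+ 2 <= e / 4.
  by rewrite -ler_pdivlMr ?exprn_gt0// -mulrA -invfM ge_min lexx orbT.
exists (fun x => t^-1 * expR (t * L x) + (- t^-1) * 1).
  apply: (proj2 (lin_closed_lspan E)); last first.
    exact: (lin_closedZ _ (lin_closed_lspan E) (lspan_gen E1)).
  by apply: lspan_gen; exists (fun x => t * L x) => //; exact: lin_closedZ.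
move=> x.
have tL : `|t * L x| <= t * M by rewrite normrM gtr0_norm// ler_wpM2l// ltW.
have := expR_lin (le_trans tL t1).
rewrite (_ : L x - _ = - (t^-1 * (expR (t * L x) - 1 - t * L x))); last first.
  by field; rewrite gt_eqF.
rewrite normrN normrM gtr0_norm ?invr_gt0// => H.
rewrite mulrC ltr_pdivrMr//; apply: le_lt_trans H _.
rewrite -(real_normK (num_real _)) (@le_lt_trans _ _ (2 * (t * M) ^+ 2))//.
  by rewrite ler_wpM2l// lerXn2r ?nnegrE// mulr_ge0// ltW.
rewrite exprMn [t ^+ 2]expr2 -mulrA mulrCA [ltRHS]mulrC ltr_pM2l//.
by lra.
Qed.

Theorem ridge_dense f : continuous f -> ucl (lspan (ridge V)) f.
Proof.
move=> fc; apply: ucl_idem.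
have : ucl (lspan E) `<=` ucl (ucl (lspan (ridge V))).
  apply: uclS; apply: lspan_ind_closed => //.
  - by apply: sub_ucl; exact: lspan0.
  - by apply: (proj2 (lin_closed_ucl (lin_closed_lspan _))).
  - move=> _ [L VL ->]; apply: cridge_ucl => //.
      exact: (continuous_bounded Tcompact (Vcont VL)).
    exact: cridge_expR.
by apply; exact: (stone_weierstrass_gen Tcompact E1 EM Ebnd EV Vcont Vgen).
Qed.

End RidgeDensity.

(** * The Daniell-Stone theorem *)

Section LinearFunctional.
Context {R : realType} {T : Type} (C : set (T -> R)) (Lam : (T -> R) -> R).
Hypothesis Clin : lin_closed C.

Definition lin_on := forall c f g, C f -> C g ->
  Lam (fun x => c * f x + g x) = c * Lam f + Lam g.

Hypothesis Lam_lin : lin_on.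

Lemma lin_on0 : Lam (fun=> 0) = 0.
Proof.
case: Clin => C0 _; have := Lam_lin (-1) C0 C0.
rewrite (_ : (fun _ => _) = fun=> 0); first by lra.
by apply/funext => x; rewrite mulr0 addr0.
Qed.

Lemma lin_onD f g : C f -> C g -> Lam (fun x => f x + g x) = Lam f + Lam g.
Proof.
move=> Cf Cg; have := Lam_lin 1 Cf Cg.
rewrite (_ : (fun _ => _) = fun x => f x + g x); first by lra.
by apply/funext => x; rewrite mul1r.
Qed.

Lemma lin_onZ c f : C f -> Lam (fun x => c * f x) = c * Lam f.
Proof.
case: Clin => C0 _ Cf; have := Lam_lin c Cf C0; rewrite lin_on0.
rewrite (_ : (fun _ => _) = fun x => c * f x); first by lra.
by apply/funext => x; rewrite addr0.
Qed.

Lemma lin_on_sum n (f : nat -> T -> R) : (forall i, C (f i)) ->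
  C (fun x => \sum_(0 <= i < n) f i x) /\
  Lam (fun x => \sum_(0 <= i < n) f i x) = \sum_(0 <= i < n) Lam (f i).
Proof.
move=> Cf; elim: n => [|n [IH1 IH2]].
  under eq_fun do rewrite big_geq//.
  by rewrite big_geq// lin_on0; case: Clin.
under eq_fun do rewrite big_nat_recr//=.
rewrite big_nat_recr//= lin_onD// IH2; split=> //.
exact: lin_closedD.
Qed.

End LinearFunctional.

(** * Integration of bounded functions against a probability measure *)

Section ProbabilityIntegral.
Context {R : realType} {d : measure_display} {T : measurableType d}.
Variables (p : probability T R) (C : set (T -> R)).
Hypothesis C_meas : forall f, C f -> measurable_fun [set: T] f.
Hypothesis Cbnd : C `<=` bounded_fun.

Lemma prob_integrable f : C f -> p.-integrable setT (EFin \o f).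
Proof.
move=> Cf; apply: measurable_bounded_integrable => //.
- by rewrite [X in (X < _)%E](probability_setT p) ltry.
- exact: C_meas.
have [M M0 fM] := Cbnd Cf; exists M; split; first exact: num_real.
move=> N MN x _.
by rewrite /= (le_trans (fM x))// ltW.
Qed.

Lemma prob_integral_lin : lin_on C (Rintegral p setT).
Proof.
move=> c f g Cf Cg; have If := prob_integrable Cf; have Ig := prob_integrable Cg.
rewrite RintegralD//; last exact: (integrableZl measurableT c If).
by rewrite RintegralZl.
Qed.

Lemma prob_integral_cst c : Rintegral p setT (fun=> c) = c.
Proof.
rewrite Rintegral_cst//=; have := probability_setT p.
by move=> ->; rewrite /= mulr1.
Qed.

Lemma le_prob_integral f g : C f -> C g -> (forall x, f x <= g x) ->
  Rintegral p setT f <= Rintegral p setT g.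
Proof. by move=> Cf Cg fg; apply: le_Rintegral => //; exact: prob_integrable. Qed.

End ProbabilityIntegral.

Section DaniellStone.
Context {R : realType} (T : pointedType) (op : set (set T)).
Variables (C : set (T -> R)) (Lam : (T -> R) -> R).
Implicit Types (f g h : T -> R) (F : nat -> T -> R) (A : set T).
Local Open Scope ereal_scope.

Definition clip (x : R) : R := Num.min 1%R (Num.max 0%R x).

Hypothesis C1 : C (fun=> 1%R).
Hypothesis Clin : lin_closed C.
Hypothesis Cmul : mul_closed C.
Hypothesis Cclip : forall f, C f -> C (clip \o f).
Hypothesis Cbnd : C `<=` bounded_fun.
Hypothesis Lam_lin : lin_on C Lam.
Hypothesis Lam_ge0 : forall f, C f -> (forall x, 0 <= f x)%R -> (0 <= Lam f)%R.
Hypothesis Lam1 : Lam (fun=> 1%R) = 1%R.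
(** Daniell's continuity condition in covering form. It bounds the outer measure of the whole space
    below by 1. *)
Hypothesis daniell : forall F, (forall n, C (F n)) -> (forall n x, 0 <= F n x)%R ->
  (forall x, 1 <= \sum_(n <oo) (F n x)%:E) -> 1 <= \sum_(n <oo) (Lam (F n))%:E.

Let CZ c f : C f -> C (fun x => c * f x)%R.
Proof. exact: lin_closedZ. Qed.

Let CD f g : C f -> C g -> C (fun x => f x + g x)%R.
Proof. exact: lin_closedD. Qed.

Let C0 : C (fun=> 0%R).
Proof. by case: Clin. Qed.

Definition cover_by A : set (nat -> T -> R) := [set F | [/\ forall n, C (F n),
  forall n x, (0 <= F n x)%R & forall x, A x -> 1 <= \sum_(n <oo) (F n x)%:E]].

(** Daniell's outer measure: the least cost of dominating the indicator of [A] by a series of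
    non-negative members of [C]. *)
Definition outer A : \bar R :=
  ereal_inf [set \sum_(n <oo) (Lam (F n))%:E | F in cover_by A].

Lemma outer_ge0 A : 0 <= outer A.
Proof.
apply: le_ereal_inf_tmp => _ [F [CF F0 _] <-].
by apply: nneseries_ge0 => n _ _; rewrite lee_fin; exact: Lam_ge0.
Qed.

Lemma le_outer : {homo outer : A B / A `<=` B >-> A <= B}.
Proof.
move=> A B AB; apply/ereal_inf_le_tmp => _ [F [CF F0 FB] <-].
by exists F => //; split=> // x /AB; exact: FB.
Qed.

Lemma outer_le A F : cover_by A F -> outer A <= \sum_(n <oo) (Lam (F n))%:E.
Proof. by move=> FA; apply: ereal_inf_lbound; exists F. Qed.

Let one_term (a : R) : \sum_(n <oo) (if n is 0%N then a else 0%R)%:E = a%:E.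
Proof.
apply: lim_near_cst => //; exists 1%N => // -[//|n] _ /=.
by rewrite big_nat_recl// big1 ?adde0// => i _.
Qed.

Lemma outer_le_Lam A g : C g -> (forall x, 0 <= g x)%R ->
  (forall x, A x -> 1 <= g x)%R -> outer A <= (Lam g)%:E.
Proof.
move=> Cg g0 gA; pose F n := if n is 0%N then g else fun=> 0%R.
rewrite (_ : (Lam g)%:E = \sum_(n <oo) (Lam (F n))%:E).
  apply: outer_le; split=> [[]|[|n] x|x Ax] //=.
  rewrite (_ : \sum_(n <oo) _ = (g x)%:E) ?lee_fin ?gA//.
  by rewrite -one_term; apply: eq_eseriesr => -[|n].
by rewrite -one_term; apply: eq_eseriesr => -[|n] _ //=; rewrite (lin_on0 Clin Lam_lin).
Qed.

Lemma outer0 : outer set0 = 0.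
Proof.
apply/eqP; rewrite eq_le outer_ge0 andbT.
have := @outer_le_Lam set0 (fun=> 0%R) C0 (fun=> lexx _).
by rewrite (lin_on0 Clin Lam_lin); apply => x.
Qed.

(** The enumeration [u] comes before the series, because the same [u] must rearrange the values F(x)
    and the numbers Lam F. *)
Let nneseries_pair : exists u : nat -> nat * nat, forall a : nat -> nat -> \bar R,
  (forall i j, 0 <= a i j) ->
  \sum_(n <oo) a (u n).1 (u n).2 = \sum_(i <oo) \sum_(j <oo) a i j.
Proof.
have /card_esym/ppcard_eqP[u] := card_nat2.
exists u => a a0.
rewrite nneseries_esumT; last by move=> n; exact: a0.
rewrite nneseries_esumT; last by move=> i; exact: nneseries_ge0.
under [RHS]eq_esum do rewrite nneseries_esumT//.
rewrite esum_esum// (_ : _ `*`` _ = [set: nat * nat]); last first.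
  by apply/seteqP; split.
by rewrite (@reindex_esum _ _ _ setT _ u).
Qed.

(** Covers of the A_n that are optimal up to e / 2^(n+1) are merged into one sequence along the
    enumeration of pairs. *)
Lemma outer_sigma_subadditive : sigma_subadditive outer.
Proof.
move=> A; have [[i ioo]|] := pselect (exists i, outer (A i) = +oo).
  rewrite (eseries_pinfty _ _ ioo) ?leey// => n _.
  by rewrite -ltNye (lt_le_trans _ (outer_ge0 _)).
rewrite -forallNE => Aoo.
apply/lee_addgt0Pr => e e0.
rewrite (le_trans _ (epsilon_trick _ _ (ltW e0)))//; last first.
  by move=> n; exact: outer_ge0.
have /choice[G PG] : forall n, exists F, cover_by (A n) F /\
    \sum_(k <oo) (Lam (F k))%:E <= outer (A n) + (e / (2 ^ n.+1)%:R)%:E.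
  move=> n; have en : (0 < e / (2 ^ n.+1)%:R)%R by rewrite divr_gt0// ltr0n expn_gt0.
  have fin : outer (A n) \is a fin_num.
    by rewrite ge0_fin_numE ?outer_ge0// lt_neqAle leey andbT; apply/eqP.
  have [_ [F FA <-] /ltW] := lb_ereal_inf_adherent en fin.
  by exists F.
have [u uE] := nneseries_pair.
have LG0 i j : 0 <= (Lam (G i j))%:E.
  by rewrite lee_fin; case: (PG i) => -[CG G0 _] _; exact: Lam_ge0.
apply: (@le_trans _ _ (\sum_(i <oo) \sum_(j <oo) (Lam (G i j))%:E)); last first.
  by apply: lee_nneseries => [i _ _|i _]; [exact: nneseries_ge0|case: (PG i)].
rewrite -uE//.
apply: outer_le; split=> [n|n x|x [i _ Aix]].
- by case: (PG (u n).1) => -[CG G0 _] _.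
- by case: (PG (u n).1) => -[CG G0 _] _.
- have G0 k j : 0 <= (G k j x)%:E by rewrite lee_fin; case: (PG k) => -[].
  rewrite (uE (fun k j => (G k j x)%:E))//.
  have [[_ _ /(_ _ Aix) Gi] _] := PG i.
  apply: (le_trans Gi); rewrite [leRHS](@nneseriesD1 _ _ i xpredT)//.
    by rewrite leeDl// nneseries_ge0// => k _ _; exact: nneseries_ge0.
  by move=> k _; exact: nneseries_ge0.
Qed.

HB.instance Definition _ := isOuterMeasure.Build R T outer
  outer0 outer_ge0 le_outer outer_sigma_subadditive.

(* Every f covering A splits as f h_K + f (1 - h_K), where h_K = clip (K g)
   increases to the indicator of {g > 0}. *)
Lemma cozero_caratheodory g : C g ->
  outer.-caratheodory [set x | (0 < g x)%R].
Proof.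
move=> Cg; set U := [set x | _]; apply: le_caratheodory_measurable => A.
apply: le_ereal_inf_tmp => _ [F [CF F0 FA] <-].
pose h (k : nat) x : R := clip (k%:R * g x).
have Ch k : C (h k) by apply: (Cclip (f := fun x => k%:R * g x)%R); exact: CZ.
have h01 k x : (0 <= h k x <= 1)%R.
  by rewrite /h /clip le_min ler01 le_max lexx /= ge_min lexx.
have hS k x : (h k x <= h k.+1 x)%R.
  have k0 : (0 <= k%:R :> R)%R by [].
  rewrite /h /clip -natr1 mulrDl mul1r le_min !ge_min lexx/=.
  case: (leP (g x) 0%R) => gx; last first.
    by apply/orP; right; rewrite ge_max !le_max lexx/= lerDl (ltW gx) orbT.
  apply/orP; right; rewrite ge_max le_max lexx/=.
  by rewrite le_max mulr_ge0_le0.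
have h0 x : h 0%N x = 0%R by rewrite /h /clip mul0r maxxx; apply/min_idPr.
have hU x : (0 < g x)%R -> exists k, h k x = 1%R.
  move=> gx; exists (Num.truncn (g x)^-1).+1.
  rewrite /h /clip; apply/min_idPl; rewrite le_max; apply/orP; right.
  by rewrite -ler_pdivrMr// mul1r ltW// truncnS_gt.
have hNU k x : ~ (0 < g x)%R -> h k x = 0%R.
  move=> /negP; rewrite -leNgt => gx; rewrite /h /clip.
  rewrite (max_idPl _); first by apply/min_idPr.
  by rewrite mulr_ge0_le0.
(* The increments are non-negative and telescope to [h K]. At a point of [U] they add up to at least
   1, so the double series of the [F n * D k] covers the trace of [A] on [U]. *)
pose D k x := (h k.+1 x + -1 * h k x)%R.
have CD' k : C (D k) by apply: CD => //; exact: CZ.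
have D0 k x : (0 <= D k x)%R by have := hS k x; rewrite /D; lra.
have CFD n k : C (fun x => F n x * D k x)%R by exact: Cmul.
have FD0 n k x : (0 <= F n x * D k x)%R by rewrite mulr_ge0.
have LFD0 n k : 0 <= (Lam (fun x => F n x * D k x)%R)%:E.
  by rewrite lee_fin Lam_ge0.
have [u uE] := nneseries_pair.
have AU : outer (A `&` U) <=
    \sum_(k <oo) \sum_(n <oo) (Lam (fun x => F n x * D k x)%R)%:E.
  rewrite -(uE (fun k n => (Lam (fun x => F n x * D k x)%R)%:E))//.
  apply: outer_le; split=> // x [Ax Ux].
  rewrite (uE (fun k n => (F n x * D k x)%:E)); last by move=> *; rewrite lee_fin.
  rewrite nneseries_interchange; last by move=> *; rewrite lee_fin.
  apply: (le_trans (FA _ Ax)); apply: lee_nneseries => [n _ _|n _]; first by rewrite lee_fin.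
  have [K hK] := hU x Ux.
  apply: (@le_trans _ _ (\sum_(0 <= k < K) (F n x * D k x)%:E)); last first.
    by apply: nneseries_lim_ge => k _ _; rewrite lee_fin.
  rewrite sumEFin lee_fin -mulr_sumr.
  rewrite (eq_bigr (fun k => h k.+1 x - h k x)%R); last by move=> k _; rewrite /D mulN1r.
  by rewrite telescope_sumr// h0 subr0 hK mulr1.
have ANU K : outer (A `&` ~` U) <= \sum_(n <oo) (Lam (fun x => F n x * (1 + -1 * h K x))%R)%:E.
  apply: outer_le; split=> [n|n x|x [Ax Ux]].
  - by apply: Cmul => //; apply: CD => //; exact: CZ.
  - by rewrite mulr_ge0//; have := h01 K x; lra.
  - by under eq_eseriesr do rewrite hNU// mulr0 addr0 mulr1; exact: FA.
(* At each finite stage F_n h_K and F_n (1 - h_K) add up to F_n exactly, so linearity of [Lam]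
   suffices. *)
have key K : \sum_(0 <= k < K) \sum_(n <oo) (Lam (fun x => F n x * D k x)%R)%:E +
    outer (A `&` ~` U) <= \sum_(n <oo) (Lam (F n))%:E.
  apply: (le_trans (leeD2l _ (ANU K))).
  have C1h n : C (fun x => F n x * (1 + -1 * h K x))%R.
    by apply: Cmul => //; apply: CD => //; exact: CZ.
  have F1h n x : (0 <= F n x * (1 + -1 * h K x))%R.
    by rewrite mulr_ge0//; have := h01 K x; lra.
  rewrite -nneseries_sum_nat// -nneseriesD//; last 2 first.
  - by move=> n _ _; apply: sume_ge0.
  - by move=> n _ _; rewrite lee_fin Lam_ge0.
  apply: lee_nneseries => n _.
    by move=> _; rewrite adde_ge0 ?lee_fin ?Lam_ge0//; apply: sume_ge0.
  have [E2 E1] := lin_on_sum Clin Lam_lin K (CFD n).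
  rewrite sumEFin -E1 -EFinD -(lin_onD Lam_lin)// lee_fin le_eqVlt; apply/orP; left; apply/eqP.
  congr Lam; apply/funext => x.
  rewrite -mulr_sumr (eq_bigr (fun k => h k.+1 x - h k x)%R); last by move=> k _; rewrite /D mulN1r.
  rewrite telescope_sumr// h0; ring.
(* The limit in K is taken after moving the outer measure of [A] minus [U] to the other side, which
   requires it to be finite; if it is infinite, [key] at K = 0 makes the right-hand side
   infinite. *)
have [fin|] := boolP (outer (A `&` ~` U) \is a fin_num); last first.
  rewrite ge0_fin_numE ?outer_ge0// -leNgt leye_eq => /eqP oo.
  have := key 0%N; rewrite big_geq// add0e oo leye_eq => /eqP ->.
  by rewrite leey.
apply: (le_trans (leeD2r _ AU)).
rewrite -leeBrDr//; apply: lime_le.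
  by apply: is_cvg_nneseries => k _ _; exact: nneseries_ge0.
by apply: nearW => K; rewrite leeBrDr.
Qed.

Hypothesis op_cozero : forall U, op U -> exists g : nat -> T -> R,
  (forall n, C (g n)) /\ U = \bigcup_n [set x | (0 < g n x)%R].

Let S := g_sigma_algebraType op.

Hypothesis C_meas : forall f, C f -> measurable_fun [set: S] (f : S -> R).

Let borel_caratheodory (A : set S) : measurable A -> outer.-cara.-measurable A.
Proof.
move: A; suff : <<s op >> `<=` outer.-cara.-measurable by [].
apply: smallest_sub.
  split=> //; [by move=> X mX; rewrite setTD; exact: measurableC |
               by move=> v mv; exact: bigcupT_measurable].
move=> U /op_cozero[g [Cg ->]].
by apply: bigcupT_measurable => n; exact: cozero_caratheodory.
Qed.

(** A copy of [outer] typed on [S], so that the measure structure is attached to the sigma-algebra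
    generated by [op]. *)
Definition stone_measure : set S -> \bar R := outer.

Let stone0 : stone_measure set0 = 0. Proof. exact: outer0. Qed.
Let stone_ge0 A : 0 <= stone_measure A. Proof. exact: outer_ge0. Qed.
Let stone_additive : semi_sigma_additive stone_measure.
Proof.
move=> F mF tF mUF; rewrite /stone_measure.
apply: caratheodory_measure_sigma_additive => //; last exact: borel_caratheodory.
by move=> i; exact: borel_caratheodory (mF i).
Qed.

HB.instance Definition _ := isMeasure.Build _ _ _ stone_measure
  stone0 stone_ge0 stone_additive.

Let stone_setT : stone_measure setT = 1.
Proof.
apply/eqP; rewrite eq_le; apply/andP; split.
  by rewrite -Lam1; apply: outer_le_Lam.
apply: le_ereal_inf_tmp => _ [F [CF F0 FT] <-].
by apply: daniell => // x; exact: FT.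
Qed.

HB.instance Definition _ := Measure_isProbability.Build _ _ _ stone_measure
  stone_setT.

(** The integral [L] is compared with [Lam] by slicing. If h = 1 on {g > 0} and 0 <= g <= 1, then L
    g <= p{g > 0} <= Lam h. Applied to the layers clip(N f - k) of a function with values in [0, 1],
    this gives N L f <= 1 + N Lam f. *)
Theorem daniell_stone : exists p : probability S R,
  forall f, C f -> fine (\int[p]_x (f x)%:E) = Lam f.
Proof.
pose p : probability S R := stone_measure.
exists p => f0 Cf0.
pose L f := Rintegral p setT f.
have iC := @prob_integrable _ _ _ p _ C_meas Cbnd.
have Llin : lin_on C L by exact: (@prob_integral_lin _ _ _ p C C_meas Cbnd).
have L1 : L (fun=> 1%R) = 1%R by exact: prob_integral_cst.
have Lle := @le_prob_integral _ _ _ p C C_meas Cbnd.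
have Lpos g h : C g -> C h -> (forall x, 0 <= g x <= 1)%R ->
    (forall x, 0 <= h x)%R -> (forall x, 0 < g x -> h x = 1)%R -> (L g <= Lam h)%R.
  move=> Cg Ch g01 h0 gh.
  pose A : set S := [set x | (0 < g x)%R].
  have mA : measurable A.
    have := C_meas Cg; rewrite -[A]setTI.
    rewrite (_ : A = g @^-1` `]0%R, +oo[%classic).
      by apply => //; exact: measurable_itv.
    by apply/seteqP; split=> x /=; rewrite /A/= in_itv/= andbT.
  have fin : p A \is a fin_num by exact: fin_num_measure.
  rewrite -lee_fin (@le_trans _ _ (p A))//; last first.
    by apply: outer_le_Lam => // x /gh ->.
  rewrite -[leRHS]fineK// lee_fin -[leRHS]mul1r.
  have <- : Rintegral p setT \1_A = (1 * fine (p A))%R.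
    by rewrite /Rintegral integral_indic// setIT mul1r.
  apply: le_Rintegral => //; first exact: iC.
    apply: measurable_bounded_integrable => //.
    - by rewrite [X in (X < _)%E](probability_setT p) ltry.
    - exact: measurable_indic.
    - exists 1%R; split=> [|N N1 x _]; first exact: num_real.
      have i1 : (`|\1_A x : R| <= 1)%R by rewrite indicE normr_nat lern1 leq_b1.
      exact: le_trans i1 (ltW N1).
  move=> x _; have /andP[g0 g1] := g01 x.
  case: (boolP (x \in A)) => [_|]; first exact: g1.
  by rewrite notin_setE /A/= => /negP; rewrite -leNgt.
have clipE (t : R) n : (0 <= t)%R ->
    (\sum_(0 <= k < n) clip (t + - k%:R * 1) = Num.min n%:R t)%R.
  move=> t0; elim: n => [|n IH].
    by rewrite big_geq//; apply/esym/min_idPl.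
  rewrite big_nat_recr//= IH /clip -natr1.
  set m := (n%:R)%R; have m0 : (0 <= m)%R by rewrite /m.
  rewrite !minEle !maxEle; case: (leP 0%R (t + - m * 1)%R) => z;
    case: (leP m t) => ?; case: (leP (m + 1)%R t) => ?; case: leP => ?; lra.
have le01 f : C f -> (forall x, 0 <= f x <= 1)%R -> (L f <= Lam f)%R.
  move=> Cf f01; apply/ler_addgt0Pl => e e0.
  pose N := (Num.truncn e^-1).+1.
  have N0 : (0 < N%:R :> R)%R by [].
  have Ne : (N%:R^-1 < e)%R.
    by rewrite -[ltRHS]invrK ltf_pV2 ?posrE ?invr_gt0// truncnS_gt.
  pose h (k : nat) x := clip (N%:R * f x + - k%:R * 1).
  have Ch k : C (h k).
    apply: (Cclip (f := fun x => N%:R * f x + - k%:R * 1)%R).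
    by apply: CD; exact: CZ.
  have h01 k x : (0 <= h k x <= 1)%R.
    by rewrite /h /clip le_min ler01 le_max lexx /= ge_min lexx.
  have sumE : (fun x => \sum_(0 <= k < N) h k x)%R = (fun x => N%:R * f x)%R.
    apply/funext => x; have /andP[fx0 fx1] := f01 x.
    rewrite clipE ?mulr_ge0//; apply/min_idPr.
    by rewrite ler_piMr.
  have [_ LN] := lin_on_sum Clin Llin N Ch.
  have [_ LamN] := lin_on_sum Clin Lam_lin N Ch.
  rewrite sumE (lin_onZ Clin Llin)// in LN.
  rewrite sumE (lin_onZ Clin Lam_lin)// in LamN.
  (* Layers are compared with a shift by one, since [h k.+1 > 0] forces [h k = 1]. The first layer
     on the left costs at most 1, and the last one on the right is dropped. *)
  have le1 : (N%:R * L f <= 1 + N%:R * Lam f)%R.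
    rewrite LN LamN big_nat_recl// [in leRHS]big_nat_recr//=.
    apply: lerD.
      by rewrite -L1; apply: Lle => // x; case/andP: (h01 0%N x).
    rewrite ler_wpDr//.
      by apply: Lam_ge0 => // x; case/andP: (h01 N.-1 x).
    apply: ler_sum => k _; apply: Lpos => // x; first by case/andP: (h01 k x).
    rewrite {1}/h /clip lt_min ltr01 lt_max ltxx/= -natr1 => H.
    by apply/min_idPl; rewrite le_max; apply/orP; right; lra.
  have h1 : (1 <= N%:R * e)%R by rewrite -ler_pdivrMl// mulr1 ltW.
  by rewrite -(ler_pM2l N0) mulrDr; lra.
have le f : C f -> (L f <= Lam f)%R.
  move=> Cf; have [M M0 fM] := Cbnd Cf.
  (* The map t |-> c t + 1/2 sends [-M, M] onto [0, 1]. *)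
  pose c := ((2 * M)^-1)%R.
  have c0 : (0 < c)%R by rewrite invr_gt0 mulr_gt0.
  have cM : (c * M = 2^-1)%R by rewrite /c; field; rewrite gt_eqF.
  have Ch : C (fun=> 2^-1 * 1)%R by exact: CZ.
  have := le01 (fun x => c * f x + 2^-1 * 1)%R _ _.
  rewrite Llin// Lam_lin// (lin_onZ Clin Llin)// (lin_onZ Clin Lam_lin)//.
  rewrite L1 Lam1 lerD2r ler_pM2l//; apply.
    by apply: CD => //; exact: CZ.
  move=> x; have := fM x; rewrite ler_norml => /andP[].
  rewrite -(ler_pM2l c0) -(ler_pM2l c0 (f x)) mulrN cM => *; apply/andP; split; lra.
(* The inequality for -f0 is the reverse inequality for f0. *)
apply/eqP; rewrite eq_le le//=.
have := le (fun x => -1 * f0 x)%R (CZ _ Cf0).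
by rewrite (lin_onZ Clin Llin)// (lin_onZ Clin Lam_lin)// !mulN1r lerN2.
Qed.

End DaniellStone.

(** * Topologies generated by functions *)

Section InitialTopology.
Context {R : realType} {T : Type}.
Implicit Types (V W : set (T -> R)) (U : set T).

(** The topology induced by [V], as a family of sets that can be equated with [opn X]. *)
Definition iopen V : set (set T) := [set U | forall x, U x ->
  exists (k : nat) (L : 'I_k -> T -> R) (r : R),
  [/\ (forall i, V (L i)), 0 < r &
      forall y, (forall i, `|L i y - L i x| < r) -> U y]].

Lemma iopenT V : iopen V setT.
Proof. by move=> x _; exists 0%N, (fun=> fun=> 0), 1; split=> // -[]. Qed.

Lemma iopenI V : setI_closed (iopen V).
Proof.
move=> A B oA oB x [/oA[k [L [r [VL r0 LA]]]] /oB[l [M [s [VM s0 MB]]]]].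
exists (k + l)%N, (fun i => match fintype.split i with inl j => L j | inr j => M j end),
  (Num.min r s); split=> [i||y Hy].
- by case: (fintype.split i).
- by rewrite lt_min r0.
- split.
    apply: LA => i; have := Hy (lshift l i).
    by rewrite (unsplitK (inl i)) lt_min => /andP[].
  apply: MB => i; have := Hy (rshift k i).
  by rewrite (unsplitK (inr i)) lt_min => /andP[].
Qed.

Lemma iopen_bigU V (I : Type) (f : I -> set T) :
  (forall i, iopen V (f i)) -> iopen V (\bigcup_i f i).
Proof.
move=> of_ x [i _ /of_[k [L [r [VL r0 Lf]]]]].
by exists k, L, r; split=> // y /Lf; exists i.
Qed.

(** An alias indexed by [V], so that several induced topologies can live on one carrier and be
    compared. *)
Definition itop V : Type := T.

HB.instance Definition _ V := gen_eqMixin (itop V).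
HB.instance Definition _ V := gen_choiceMixin (itop V).
HB.instance Definition _ V := isOpenTopological.Build (itop V)
  (iopenT V) (@iopenI V) (@iopen_bigU V).

Lemma itop_openE V : (open : set (set (itop V))) = iopen V.
Proof. by []. Qed.

Lemma itop_continuous V L : V L -> continuous (L : itop V -> R).
Proof.
move=> VL x; apply/(@cvgrPdist_lt _ _ _ _ (@nbhs_filter (itop V) x)) => e e0.
rewrite nbhsE; exists [set y | `|L x - L y| < e] => //; split; last first.
  by rewrite /= subrr normr0.
rewrite itop_openE => y /= xy.
exists 1%N, (fun=> L), (e - `|L x - L y|); split=> //; first by rewrite subr_gt0.
move=> z /(_ ord0); rewrite -(distrC (L y)) => yz.
rewrite (_ : L x - L z = (L x - L y) + (L y - L z)); last by ring.
by rewrite (le_lt_trans (ler_normD _ _))//; lra.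
Qed.

Lemma itop_generates V : generates (T := itop V) V.
Proof.
move=> x U; rewrite nbhsE => -[B [oB Bx] BU].
have /(_ x Bx)[k [L [r [VL r0 LB]]]] : iopen V B := oB.
by exists k, L, r; split=> // y /LB /BU.
Qed.

Lemma iopen_nbhs V U : (forall x : itop V, U x -> nbhs x U) -> iopen V U.
Proof. by rewrite -itop_openE openE. Qed.

Lemma generated_nbhs (S : topologicalType) k (L : 'I_k -> S -> R) r (x : S) :
  (forall i, continuous (L i)) -> 0 < r ->
  nbhs x [set y | forall i, `|L i y - L i x| < r].
Proof.
move=> Lc r0; apply: filter_forall => i.
have /cvgrPdist_lt/(_ _ r0) := Lc i x.
by apply: filterS => y; rewrite distrC.
Qed.

Lemma iopen_sub V W :
  (forall L, V L -> continuous (L : itop W -> R)) -> iopen V `<=` iopen W.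
Proof.
move=> VW U oU; apply: iopen_nbhs => x /oU[k [L [r [VL r0 LU]]]].
have := @generated_nbhs (itop W) k L r x (fun i => VW _ (VL i)) r0.
by apply: filterS => y; exact: LU.
Qed.

Lemma iopen_eq V W :
  (forall L, V L -> continuous (L : itop W -> R)) ->
  (forall L, W L -> continuous (L : itop V -> R)) -> iopen V = iopen W.
Proof. by move=> VW WV; apply/seteqP; split; exact: iopen_sub. Qed.

End InitialTopology.

Lemma iopen_preimage {R : realType} (T T' : Type) (u : T -> T')
    (V : set (T -> R)) (W : set (T' -> R)) U :
  (forall L, W L -> V (L \o u)) -> iopen W U -> iopen V (u @^-1` U).
Proof.
move=> WV oU x /oU[k [L [r [WL r0 LU]]]].
by exists k, (fun i => L i \o u), r; split=> // [i|y /LU//]; apply: WV; exact: WL.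
Qed.

Lemma itop_comp_continuous {R : realType} (T T' : Type) (u : T -> T')
    (V : set (T -> R)) (W : set (T' -> R)) f :
  (forall L, W L -> V (L \o u)) -> continuous (f : itop W -> R) ->
  continuous (f \o u : itop V -> R).
Proof.
move=> WV /continuousP fc; apply/continuousP => A /fc.
by rewrite !itop_openE comp_preimage; exact: iopen_preimage.
Qed.

Section ContinuousFunctions.
Context {R : realType} {T : topologicalType}.

Definition cfun : set (T -> R) := [set f | continuous f].

Lemma cfun_lin : lin_closed cfun.
Proof.
split=> [x|c f g fc gc x]; first exact: cvg_cst.
exact: (lin_closed_continuous_at x).2 c f g (fc x) (gc x).
Qed.

Lemma cfun_cst c : cfun (fun=> c).
Proof. by move=> x; exact: cvg_cst. Qed.

Lemma cfun_mul : mul_closed cfun.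
Proof. by move=> f g fc gc x; apply: cvgM; [exact: fc|exact: gc]. Qed.

Lemma cfun_ucl : ucl cfun `<=` cfun.
Proof.
move=> f fu x; apply/cvgrPdist_lt => e e0.
have e30 : 0 < e / 3 by rewrite divr_gt0.
have [g gc fg] := fu _ e30; have /cvgrPdist_lt/(_ _ e30) := gc x.
apply: filterS => y gxy.
have h1 := fg x; have h2 := fg y; rewrite distrC in h2.
rewrite (_ : f x - f y = (f x - g x) + ((g x - g y) + (g y - f y))); last by ring.
rewrite (le_lt_trans (ler_normD _ _))//.
by have := ler_normD (g x - g y) (g y - f y); lra.
Qed.

Lemma cfun_lspan G : G `<=` cfun -> lspan G `<=` cfun.
Proof.
move=> Gc; apply: lspan_ind_closed => //; first exact: cfun_cst.
by move=> c f g; exact: (proj2 cfun_lin).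
Qed.

Lemma cfun_norm f : cfun f -> cfun (fun x => `|f x|).
Proof. by move=> fc x; apply: cvg_norm; exact: fc. Qed.

Lemma cfun_clip f : cfun f -> cfun (clip \o f).
Proof.
move=> fc x; apply: continuous_comp; first exact: fc.
by apply: continuous_min; [exact: cvg_cst|apply: continuous_max; [exact: cvg_cst|exact: cvg_id]].
Qed.

End ContinuousFunctions.
Arguments cfun R T : clear implicits.

(** Compactness of a bare family of open sets. Ultrafilters are used because they push forward along
    maps such as projections and integrals. *)
Definition ultra_compact {T : Type} (op : set (set T)) :=
  forall F : set (set T), UltraFilter F -> exists x, forall U, op U -> U x -> F U.

Lemma itop_compact {R : realType} {T : Type} (V : set (T -> R)) :
  ultra_compact (iopen V) -> compact [set: itop V].
Proof.
move=> Vc; rewrite compact_ultra => F FU _; have [x Fx] := Vc F FU.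
exists x; split=> // U; rewrite nbhsE => -[B [oB Bx] BU].
by apply: (filterS BU); exact: Fx.
Qed.

Lemma fmap_ultra {T S : Type} (f : T -> S) (F : set_system T) :
  UltraFilter F -> UltraFilter (f @ F).
Proof.
move=> FU; split; first exact: fmap_proper_filter.
move=> G GP FG; apply/seteqP; split=> // A GA.
have [//|FNA] := in_ultra_setVsetC (f @^-1` A) FU.
have GNA : G (~` A) by apply: FG.
have GI : G (A `&` ~` A) by exact: filterI.
by have [x []] := filter_ex GI.
Qed.

(** * The invariant carried through the class *)

Section Good.
Context {R : realType} (sigma : R -> R).
Hypothesis sigma_cont : continuous sigma.
Hypothesis sigma_not_poly : ~ exists P : {poly R}, forall x, sigma x = P.[x].
Implicit Types X : cspace R.

(** The countable family makes open sets countable unions of cozero sets, as the Riesz theorem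
    requires; compactness serves Stone-Weierstrass; [V] presents the networks as ridge functions
    over forms that induce the topology. *)
Definition good X := [/\
  exists phi : nat -> car X -> R, opn X = iopen (range phi),
  ultra_compact (opn X) &
  exists V : set (car X -> R),
    [/\ lin_closed V, opn X = iopen V & nets X = lspan (ridge sigma V)]].

Lemma contP X (V : set (car X -> R)) f : opn X = iopen V ->
  cont f <-> continuous (f : itop V -> R).
Proof. by move=> XV; rewrite /cont XV continuousP. Qed.

Lemma good_nets_cont X g : good X -> nets X g -> cont g.
Proof.
move=> [_ _ [V [Vlin XV ->]]] gV; apply/(contP _ XV).
apply: (@cfun_lspan _ (itop V) (ridge sigma V) _ g gV) => _ [L [b [VL ->]]] x.
have Lc : cfun R (itop V) L by exact: itop_continuous.
have bLc := lin_closedD cfun_lin (@cfun_cst _ (itop V) b) Lc.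
apply: (@continuous_comp (itop V) _ _ (fun x => b + L x) sigma).
  exact: bLc.
exact: sigma_cont.
Qed.

Lemma good_dense X f : good X -> cont f -> ucl (nets X) f.
Proof.
move=> [_ Xc [V [Vlin XV ->]]] /(contP _ XV) fc.
apply: (@ridge_dense _ sigma sigma_cont sigma_not_poly (itop V) V) => //.
- by apply: itop_compact; rewrite -XV.
- by move=> L; exact: itop_continuous.
- exact: itop_generates.
Qed.

Lemma good_lin X : good X -> lin_closed (nets X).
Proof. by move=> [_ _ [V [_ _ ->]]]; exact: lin_closed_lspan. Qed.

End Good.

(** * Spaces of probability measures *)

Section Riesz.
Context {R : realType} (X : cspace R) (phi : nat -> car X -> R) (x0 : car X).
Hypothesis XE : opn X = iopen (range phi).
Hypothesis Xc : ultra_compact (opn X).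
Let W := range phi.
Let T : topologicalType := itop W.

Let Tc : compact [set: T].
Proof. by apply: itop_compact; rewrite -XE. Qed.

Let contE : [set f | @cont R X f] = cfun R T.
Proof. by apply/seteqP; split=> f; rewrite /= (contP _ XE). Qed.

(** The cozero set of [c (q, m)] is a rational neighbourhood: the sum of the |phi_i - q_i| is less
    than 1 / (m + 1). There are countably many of them, and those inside [U] cover [U]. *)
Lemma cozero_base U : opn X U -> exists g : nat -> car X -> R,
  (forall n, cont (g n)) /\ U = \bigcup_n [set x | 0 < g n x].
Proof.
rewrite {1}XE => oU.
pose c (t : seq rat * nat) (y : car X) : R :=
  t.2.+1%:R^-1 + (-1) * \sum_(i < size t.1) `|phi i y + - (ratr (nth 0 t.1 i))|.
have cc t : cfun R T (c t).
  apply: (lin_closedD cfun_lin); first exact: cfun_cst.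
  apply: (lin_closedZ _ cfun_lin); apply: (lin_closed_sum cfun_lin) => i.
  have phic : cfun R T (phi i) by apply: itop_continuous; exists i.
  apply: (@cfun_norm R T).
  exact: (lin_closedD cfun_lin phic (@cfun_cst R T (- ratr (nth 0 t.1 i)))).
pose good_index t := [set y | 0 < c t y] `<=` U.
(* Integers that code no pair, or a neighbourhood not inside [U], give the zero function, whose
   cozero set is empty. *)
pose g n := if unpickle n is Some t then
  if pselect (good_index t) then c t else fun=> 0 else fun=> 0.
have gE t : good_index t -> g (pickle t) = c t.
  by move=> gt; rewrite /g pickleK; case: pselect.
have gc n : cfun R T (g n).
  rewrite /g; case: unpickle => [t|]; last exact: cfun_cst.
  by case: pselect => gt; [exact: cc|exact: cfun_cst].
have gU n x : 0 < g n x -> U x.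
  rewrite /g; case: unpickle => [t|]; last by rewrite ltxx.
  by case: pselect => [gt /gt//|ngt]; rewrite ltxx.
exists g; split=> [n|].
  by have := gc n; rewrite -contE.
apply/seteqP; split=> [x Ux|x [n _]]; last exact: gU.
have [k [L [r [VL r0 LU]]]] := oU x Ux.
have /choice[u Hu] : forall i : 'I_k, exists n, phi n = L i.
  by move=> i; have [n _ <-] := VL i; exists n.
(* [N] exceeds every index used and is positive even for [k = 0], so that the final comparison of
   sums is strict. *)
pose N := (\max_(i < k) u i).+1.
pose m := Num.truncn (2 / r).
have m0 : 0 < m.+1%:R^-1 :> R by rewrite invr_gt0.
have mr : 2 * m.+1%:R^-1 < r.
  by rewrite -ltr_pdivlMr ?invr_gt0// invrK mulrC -ltr_pdivrMr// truncnS_gt.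
pose d : R := m.+1%:R^-1 / N%:R.
have d0 : 0 < d by rewrite divr_gt0.
have /choice[q Hq] : forall i : nat, exists q : rat, `|phi i x + - ratr q| < d.
  move=> i; have [q] : exists q, ratr q \in `](phi i x - d), (phi i x + d)[%R.
    by apply: rat_in_itvoo; lra.
  rewrite in_itv/= => /andP[q1 q2]; exists q.
  by rewrite ltr_norml; apply/andP; split; lra.
pose t := (mkseq q N, m).
have cE y : c t y = m.+1%:R^-1 - \sum_(i < N) `|phi i y + - ratr (q i)|.
  rewrite -mulN1r -[c t y]/(m.+1%:R^-1 + (-1) *
    \sum_(i < size (mkseq q N)) `|phi i y + - ratr (nth 0 (mkseq q N) i)|).
  rewrite size_mkseq; congr (_ + _ * _); apply: eq_bigr => i _.
  by rewrite nth_mkseq.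
have gt : good_index t.
  move=> y /=; rewrite cE subr_gt0 => cy.
  apply: LU => i; rewrite -Hu.
  have uN : (u i < N)%N by rewrite ltnS (@leq_bigmax _ u i).
  have d1 : `|phi (u i) x + - ratr (q (u i))| < m.+1%:R^-1.
    by rewrite (lt_le_trans (Hq _))// /d ler_pdivrMr// ler_peMr ?ler1n//.
  have d2 : `|phi (u i) y + - ratr (q (u i))| < m.+1%:R^-1.
    apply: le_lt_trans cy; rewrite (bigD1 (Ordinal uN))//=.
    by rewrite lerDl sumr_ge0.
  apply: lt_trans mr.
  rewrite (_ : _ - _ = (phi (u i) y + - ratr (q (u i))) -
    (phi (u i) x + - ratr (q (u i)))); last by ring.
  apply: (le_lt_trans (ler_normB _ _)); rewrite mulr_natl mulr2n.
  exact: ltrD.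
exists (pickle t); first exact: I.
rewrite /mkset gE//; rewrite cE subr_gt0.
have -> : m.+1%:R^-1 = \sum_(i < N) d.
  by rewrite sumr_const card_ord -[RHS]mulr_natr /d divfK ?pnatr_eq0.
apply: ltr_sum; first by apply/hasP; exists (Ordinal (ltn0Sn _)); rewrite ?mem_index_enum.
by move=> i _; exact: Hq.
Qed.

Lemma cont_measurable f : cont f -> measurable_fun [set: borel_of R x0] (f : borel_of R x0 -> R).
Proof.
move=> fc; apply: (measurability _ (RGenOpens.measurableE R)).
move=> _ [_ [a [b ->] <-]]; rewrite setTI.
by apply: sub_sigma_algebra; apply: fc; exact: interval_open.
Qed.

(** Some partial sum exceeds 1 - e at each point, hence by compactness one partial sum is at least 1
    - e everywhere, and positivity of [Lam] carries this bound over. *)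
Lemma dini (Lam : (car X -> R) -> R) (F : nat -> car X -> R) :
  lin_on (cfun R T) Lam ->
  (forall f, cfun R T f -> (forall x, 0 <= f x) -> 0 <= Lam f) ->
  Lam (fun=> 1) = 1 ->
  (forall n, cfun R T (F n)) -> (forall n x, 0 <= F n x) ->
  (forall x, 1 <= \sum_(n <oo) (F n x)%:E)%E -> (1 <= \sum_(n <oo) (Lam (F n))%:E)%E.
Proof.
move=> Llin Lpos L1 CF F0 FT; apply/lee_addgt0Pr => e e0.
have /choice[N HN] : forall x : T, exists N, 1 - e < \sum_(0 <= n < N) F n x.
  move=> x; apply: contrapT => /forallNP H.
  have : (\sum_(n <oo) (F n x)%:E <= (1 - e)%:E)%E.
    apply: lime_le; first by apply: is_cvg_nneseries => n _ _; rewrite lee_fin.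
    by apply: nearW => n; rewrite sumEFin lee_fin leNgt; apply/negP/H.
  move=> /(le_trans (FT x)); rewrite lee_fin; lra.
have CS n := lin_on_sum cfun_lin Llin n CF.
have [x|s Hs] := @compact_seq_cover T Tc (fun x => [set y | 1 - e < \sum_(0 <= n < N x) F n y]).
  have [+ _] := CS (N x) => /(_ x) /(@cvgr_gt _ _ _ (@nbhs_filter T x)).
  by apply; exact: HN.
pose M := \max_(x <- s) N x.
have FM y : 1 - e <= \sum_(0 <= n < M) F n y.
  have [x xs /= /ltW H] := Hs y; apply: (le_trans H).
  have NM : (N x <= M)%N by rewrite /M (big_rem x)//= leq_maxl.
  by rewrite (big_cat_nat (leq0n _) NM)//= lerDl sumr_ge0.
have [CM LM] := CS M.
have : 1 - e <= \sum_(0 <= n < M) Lam (F n).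
  have Lc c : Lam (fun=> c) = c.
    have := lin_onZ cfun_lin Llin c (@cfun_cst R T 1).
    by rewrite mulr1 L1 mulr1.
  have Cc : cfun R T (fun=> e - 1) by exact: cfun_cst.
  have := Lpos _ (lin_closedD cfun_lin CM Cc).
  rewrite (lin_onD Llin CM Cc) LM Lc => H.
  suff : 0 <= \sum_(0 <= i < M) Lam (F i) + (e - 1) by lra.
  by apply: H => x; have := FM x; lra.
move=> H; have : (1%:E <= \sum_(0 <= n < M) (Lam (F n))%:E + e%:E)%E.
  by rewrite sumEFin -EFinD lee_fin; lra.
move=> /le_trans; apply; apply: leeD2r; apply: nneseries_lim_ge => n _ _.
by rewrite lee_fin; exact: Lpos.
Qed.

Theorem riesz (Lam : (car X -> R) -> R) : lin_on [set f | @cont R X f] Lam ->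
  (forall f, @cont R X f -> (forall x, 0 <= f x) -> 0 <= Lam f) ->
  Lam (fun=> 1) = 1 ->
  exists p : probability (borel_of R x0) R, forall f, cont f -> integ R p f = Lam f.
Proof.
move=> Llin Lpos L1.
rewrite contE in Llin.
have Lpos' f : cfun R T f -> (forall x, 0 <= f x) -> 0 <= Lam f.
  by rewrite -contE; exact: Lpos.
have Cbnd : cfun R T `<=` bounded_fun by move=> f; exact: continuous_bounded.
have Cdini F : (forall n, cfun R T (F n)) -> (forall n x, 0 <= F n x) ->
    (forall x, 1 <= \sum_(n <oo) (F n x)%:E)%E ->
    (1 <= \sum_(n <oo) (Lam (F n))%:E)%E by exact: dini.
have Copen U : opn X U -> exists g : nat -> car X -> R,
    (forall n, cfun R T (g n)) /\ U = \bigcup_n [set x | 0 < g n x].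
  by rewrite -contE; exact: cozero_base.
have Cmeas f : cfun R T f -> measurable_fun [set: borel_of R x0] (f : borel_of R x0 -> R).
  by rewrite -contE; exact: cont_measurable.
have [p Hp] := @daniell_stone R (ptd x0) (opn X) (cfun R T) Lam (@cfun_cst R T 1)
  (@cfun_lin R T) (@cfun_mul R T) (@cfun_clip R T) Cbnd Llin Lpos' L1 Cdini Copen Cmeas.
exists p => f fc; apply: Hp; rewrite -contE; exact: fc.
Qed.


End Riesz.

(** * Topology and compactness of the space of measures *)

Section MeasureSpace.
Context {R : realType} (sigma : R -> R).
Context (X : cspace R) (phi : nat -> car X -> R) (x0 : car X).
Hypothesis XE : opn X = iopen (range phi).
Hypothesis Xc : ultra_compact (opn X).
Let T : topologicalType := itop (range phi).
Let P := probability (borel_of R x0) R.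
Implicit Types (p q : P) (f g : car X -> R).

Let Tc : compact [set: T].
Proof. by apply: itop_compact; rewrite -XE. Qed.

Let contP' f : cont f <-> cfun R T f.
Proof. exact: contP. Qed.

Let C : set (car X -> R) := [set f | cont f].

Let Clin : lin_closed C.
Proof.
have [C0 CS] := @cfun_lin R T; split; first exact/contP'.
by move=> c f g /contP' fc /contP' gc; apply/contP'; exact: CS.
Qed.

Let Ccst c : C (fun=> c).
Proof. by apply/contP'; exact: cfun_cst. Qed.

Let Cbnd : C `<=` bounded_fun.
Proof. by move=> f /contP'; exact: continuous_bounded. Qed.

Definition evi f : P -> R := fun p => integ R p f.

Lemma integ_lin p : lin_on C (integ R p).
Proof. exact: (prob_integral_lin p (@cont_measurable _ X x0) Cbnd). Qed.

Lemma integ_cst p c : integ R p (fun=> c) = c.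
Proof. exact: prob_integral_cst. Qed.

Lemma integ_le p f g : cont f -> cont g -> (forall x, f x <= g x) ->
  integ R p f <= integ R p g.
Proof. exact: (le_prob_integral p (@cont_measurable _ X x0) Cbnd). Qed.

(** Total mass 1 makes integration 1-Lipschitz, so uniform approximation of functions passes to
    their integrals, uniformly in [p]. *)
Lemma integ_dist p f g e : cont f -> cont g -> (forall x, `|f x - g x| <= e) ->
  `|integ R p f - integ R p g| <= e.
Proof.
move=> fc gc fg.
have H h k : cont h -> cont k -> (forall x, h x <= k x + e) ->
    integ R p h <= integ R p k + e.
  move=> hc kc hk; rewrite -(integ_cst p e) -(lin_onD (@integ_lin p) kc (Ccst e)).
  by apply: integ_le => //; exact: (lin_closedD Clin kc (Ccst e)).
have h1 : integ R p f <= integ R p g + e.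
  by apply: H => // x; have := fg x; rewrite ler_norml => /andP[]; lra.
have h2 : integ R p g <= integ R p f + e.
  by apply: H => // x; have := fg x; rewrite ler_norml => /andP[]; lra.
by rewrite ler_norml; apply/andP; split; lra.
Qed.

Lemma evi_ucl (A : set (car X -> R)) f : A `<=` C -> cont f -> ucl A f ->
  ucl [set evi g | g in A] (evi f).
Proof.
move=> AC fc fA e e0; have e20 : 0 < e / 2 by rewrite divr_gt0.
have [g Ag fg] := fA _ e20; exists (evi g); first by exists g.
move=> p; apply: le_lt_trans (_ : e / 2 < e); last by lra.
by apply: integ_dist => //; [exact: AC|move=> x; exact: ltW].
Qed.

Lemma evi_lspan (A : set (car X -> R)) f : A `<=` C -> lspan A f ->
  lspan [set evi g | g in A] (evi f).
Proof.
move=> AC fA.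
suff [] : C f /\ lspan [set evi g | g in A] (evi f) by [].
(* Continuity is carried along because the integral is linear only on [C]. *)
pose Q f := C f /\ lspan [set evi g | g in A] (evi f).
apply: (@lspan_ind_closed _ _ A Q _ _ _ f fA) => [|c h g [hc Lh] [gc Lg]|h Ah].
- split; first by case: Clin.
  rewrite (_ : evi _ = fun=> 0); first exact: lspan0.
  by apply/funext => p; exact: integ_cst.
- split; first by case: Clin => _; exact.
  rewrite (_ : evi _ = fun p => c * evi h p + evi g p).
    exact/lspanD/Lg/lspanZ.
  by apply/funext => p; exact: integ_lin.
- by split; [exact: AC|apply: lspan_gen; exists h].
Qed.

(** Monomials in the [phi n]: closed under products, with dense span, and indexed by a countable
    type. Their integrals are a countable family inducing the topology of the space of measures. *)
Definition mono (s : seq nat) : car X -> R := fun x => \prod_(n <- s) phi n x.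

Let mono_cont s : cont (mono s).
Proof.
apply/contP'; rewrite /mono; elim: s => [|n s IH].
  by under eq_fun do rewrite big_nil; exact: cfun_cst.
under eq_fun do rewrite big_cons.
by apply: (@cfun_mul R T) => //; apply: itop_continuous; exists n.
Qed.

Lemma mono_dense f : cont f -> ucl (lspan (range mono)) f.
Proof.
move=> /contP' fc.
have M1 : range mono (fun=> 1).
  by exists [::] => //; apply/funext => x; rewrite /mono big_nil.
have Mmul : mul_closed (range mono).
  move=> _ _ [s _ <-] [t _ <-]; exists (s ++ t) => //.
  by apply/funext => x; rewrite /mono big_cat.
have Mbnd : range mono `<=` bounded_fun.
  by move=> _ [s _ <-]; apply: Cbnd; exact: mono_cont.
have phiM : range phi `<=` ucl (lspan (range mono)).
  move=> _ [n _ <-]; apply/sub_ucl/lspan_gen; exists [:: n] => //.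
  by apply/funext => x; rewrite /mono big_seq1.
exact: (@stone_weierstrass_gen R T (range mono) (range phi) Tc M1 Mmul Mbnd phiM
  (@itop_continuous _ _ _) (@itop_generates _ _ _) f fc).
Qed.

Lemma meas_opnE : opn (meas_space R sigma x0) = iopen [set evi f | f in C].
Proof.
apply/seteqP; split=> U oU p /oU.
  move=> [k [f [r [r0 [fc fU]]]]].
  exists k, (fun i => evi (f i)), r; split=> // i.
  by exists (f i) => //; exact: fc.
move=> [k [L [r [VL r0 LU]]]].
have /choice[f Hf] : forall i, exists f, cont f /\ evi f = L i.
  by move=> i; have [f fc <-] := VL i; exists f.
exists k, f, r; split=> //; split=> [i|q Hq]; first by case: (Hf i).
by apply: LU => i; have [_ <-] := Hf i; exact: Hq.
Qed.

Lemma meas_compact : ultra_compact (opn (meas_space R sigma x0)).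
Proof.
change (forall F : set_system P, UltraFilter F -> exists p : P, forall U : set P,
  opn (meas_space R sigma x0) U -> U p -> F U).
move=> F FU.
(* The integrals of a bounded [f] stay in a segment, so they converge along the ultrafilter; [Lam]
   is unconstrained off the continuous functions. *)
have /choice[Lam HL] : forall f, exists l : R, cont f -> evi f @ F --> l.
  move=> f; have [fc|fnc] := pselect (cont f); last by exists 0.
  have [M M0 fM] := Cbnd fc.
  have := @segment_compact R (- M) M; rewrite compact_ultra.
  move=> /(_ (evi f @ F) (fmap_ultra _ FU))[|l [_ Fl]]; last by exists l.
  rewrite /fmap/=; apply: filterS filterT => p _ /=.
  rewrite in_itv/= -ler_norml.
  have := @integ_dist p f (fun=> 0) M fc (Ccst 0); rewrite integ_cst subr0.
  by apply => x; rewrite subr0.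
have LamE f l : cont f -> evi f @ F --> l -> Lam f = l.
  by move=> fc; apply: (cvg_unique _ (HL f fc)); exact: Rhausdorff.
have Llin : lin_on C Lam.
  move=> c f g fc gc; apply: LamE; first by case: Clin => _; exact.
  rewrite (_ : evi _ = fun p => c * evi f p + evi g p); last first.
    by apply/funext => p; exact: integ_lin.
  by apply: cvgD; [apply: cvgM; [exact: cvg_cst|exact: HL]|exact: HL].
have Lcst c : Lam (fun=> c) = c.
  apply: LamE; first exact: Ccst.
  rewrite (_ : evi _ = fun=> c); first exact: cvg_cst.
  by apply/funext => p; exact: integ_cst.
have Lpos f : cont f -> (forall x, 0 <= f x) -> 0 <= Lam f.
  move=> fc f0; apply: (cvgr_to_ge (HL f fc)); apply: nearW => p.
  by have := @integ_le p _ _ (Ccst 0) fc f0; rewrite integ_cst.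
have [p Hp] := @riesz R X phi x0 XE Xc Lam Llin Lpos (Lcst 1).
exists p => U oU Up; have [k [f [r [r0 [fc fU]]]]] := oU p Up.
have : F [set q : P | forall i, `|integ R q (f i) - integ R p (f i)| < r].
  apply: filter_forall => i; rewrite Hp//.
  have /cvgrPdist_lt/(_ _ r0) := HL _ (fc i).
  by apply: filterS => q; rewrite distrC.
by apply: filterS => q; exact: fU.
Qed.

(** The integral of any continuous function is a uniform limit of integrals of members of [A], hence
    continuous for the topology these induce. *)
Lemma meas_nets_dense (A : set (car X -> R)) : A `<=` C ->
  (forall f, cont f -> ucl A f) ->
  opn (meas_space R sigma x0) = iopen [set evi f | f in A].
Proof.
move=> AC Ad; rewrite meas_opnE; apply: iopen_eq => _ [f fc <-].
  apply: (@cfun_ucl R (itop [set evi f | f in A])).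
  apply: uclS (evi_ucl AC fc (Ad _ fc)) => L; exact: itop_continuous.
by apply: itop_continuous; exists f => //; exact: AC.
Qed.

Lemma meas_countable : exists psi : nat -> P -> R,
  opn (meas_space R sigma x0) = iopen (range psi).
Proof.
(* An integer coding no list gives the empty monomial, the constant 1. *)
pose psi n := evi (mono (odflt [::] (unpickle n))); exists psi.
pose W := range psi; rewrite meas_opnE.
have monoW s : W (evi (mono s)) by exists (pickle s) => //; rewrite /psi pickleK.
have mC : range mono `<=` C by move=> _ [s _ <-]; exact: mono_cont.
have lmC : lspan (range mono) `<=` C.
  by case: Clin => C0 CS; apply: lspan_ind_closed.
apply: iopen_eq => [_ [f fc <-]|_ [n _ <-]]; last first.
  apply: itop_continuous; exists (mono (odflt [::] (unpickle n))) => //.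
  exact: mono_cont.
apply: (@cfun_ucl R (itop W)).
apply: uclS (evi_ucl lmC fc (mono_dense fc)) => _ [g mg <-].
have := evi_lspan mC mg; apply: (@cfun_lspan R (itop W)) => _ [_ [s _ <-] <-].
exact: itop_continuous.
Qed.

End MeasureSpace.

Lemma good_meas {R : realType} (sigma : R -> R) (X : cspace R) (x0 : car X) :
  continuous sigma -> (~ exists P : {poly R}, forall x, sigma x = P.[x]) ->
  good sigma X -> good sigma (meas_space R sigma x0).
Proof.
move=> sc snp Xg; have [[phi XE] Xc _] := Xg; split.
- exact: meas_countable XE Xc.
- exact: meas_compact XE Xc.
have Nc : nets X `<=` [set f | cont f] by move=> f; exact: good_nets_cont.
have Nlin := good_lin Xg.
(* A weighted sum of integrals of networks is the integral of one network, so the integrals alone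
   form the vector space of forms. *)
exists [set evi f | f in nets X]; split.
- split=> [|c _ _ [f Nf <-] [g Ng <-]].
    exists (fun=> 0); first by case: Nlin.
    by apply/funext => p; exact: integ_cst.
  exists (fun x => c * f x + g x); first by case: Nlin => _; exact.
  by apply/funext => p; apply: (@integ_lin R X phi x0 XE Xc p); exact: Nc.
- apply: (@meas_nets_dense R sigma X phi x0 XE Xc _ Nc) => f fc.
  exact: good_dense.
apply/seteqP; split=> [g [n [a [b [m [w [f [Nf gE]]]]]]]|g /lspanP[n [a [h [Hh ->]]]]].
  apply/lspanP; exists n, a, (fun i p => sigma (b i + \sum_(k < m i) w i k * integ R p (f i k))).
  split=> [i|]; last exact/funext.
  exists (fun p => \sum_(k < m i) w i k * integ R p (f i k)), (b i); split=> //.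
  have Nwf k : nets X (fun x => w i k * f i k x) by exact: lin_closedZ.
  exists (fun x => \sum_(k < m i) w i k * f i k x); first exact: lin_closed_sum.
  apply/funext => p; rewrite /evi.
  elim: (m i) (w i) (f i) (Nf i) Nwf => [|k IH] w' f' Nf' Nwf'.
    rewrite big_ord0 (_ : (fun _ => _) = fun=> 0) ?integ_cst//.
    by apply/funext => x; rewrite big_ord0.
  rewrite big_ord_recl -IH//.
  rewrite -(@integ_lin R X phi x0 XE Xc p).
  - by congr integ; apply/funext => x; rewrite big_ord_recl.
  - exact: Nc.
  - by apply: Nc; exact: lin_closed_sum.
have /choice[fb Hfb] : forall i, exists fb : (car X -> R) * R,
    nets X fb.1 /\ h i = fun p => sigma (fb.2 + integ R p fb.1).
  by move=> i; have [_ [b [[f Nf <-] ->]]] := Hh i; exists (f, b).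
(* Conversely, one integral with weight 1 suffices in each unit. *)
exists n, a, (fun i => (fb i).2), (fun=> 1%N), (fun _ _ => 1), (fun i _ => (fb i).1).
split=> [i _|p]; first by case: (Hfb i).
apply: eq_bigr => i _; have [_ ->] := Hfb i.
by rewrite big_ord1 mul1r.
Qed.

(** * Subsets of R^d and finite products *)

Section BaseSpace.
Context {R : realType} (sigma : R -> R) (d : nat) (K : set 'rV[R]_d).
Let S := {x : 'rV[R]_d | K x}.
Let coord (k : 'I_d) : S -> R := fun x => sval x 0 k.

Let base_opnE : opn (base_space R sigma K) = iopen (range coord).
Proof.
apply/seteqP; split=> [_ [V [oV ->]] x Vx|U oU].
  have /nbhs_ballP[e /= e0 eV] : nbhs (sval x) V by exact: open_nbhs_nbhs.
  exists d, coord, e; split=> // [k|y Hy]; first by exists k.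
  by apply: eV; split=> // i j; rewrite (ord1 i) /ball/= distrC; exact: Hy.
(* The largest ambient open set whose trace lies in [U]. *)
exists (\bigcup_(O in [set O | open O /\
  [set x : S | O (sval x)] `<=` U]) O); split.
  by apply: bigcup_open => V [].
apply/seteqP; split=> [x Ux|x [V [_ VU] Vx]]; last exact: VU.
have [k [L [r [VL r0 LU]]]] := oU x Ux.
exists (ball (sval x) r); last exact: ballxx.
split=> [|y /= xy]; first exact: ball_open.
apply: LU => i; have [j _ <-] := VL i.
by case: xy => _ xy; rewrite distrC; exact: xy.
Qed.

Let base_compact : compact K -> ultra_compact (opn (base_space R sigma K)).
Proof.
rewrite compact_ultra => Kc.
change (forall F : set_system S, UltraFilter F -> exists p : S, forall U : set S,
  opn (base_space R sigma K) U -> U p -> F U).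
move=> F FU.
have FK : ((fun x : S => sval x) @ F) K.
  by rewrite /fmap/=; apply: filterS filterT => x _; exact: (proj2_sig x).
have [x [Kx Fx]] := Kc _ (fmap_ultra (fun x : S => sval x) FU) FK.
exists (exist _ x Kx) => _ [V [oV ->]] Vx.
by apply: Fx; exact: open_nbhs_nbhs.
Qed.

Lemma good_base : compact K -> good sigma (base_space R sigma K).
Proof.
move=> Kc; split; last 1 first.
- exists (lspan (range coord)); split.
  + exact: lin_closed_lspan.
  + rewrite base_opnE; apply: iopen_eq => L.
      by move=> VL; apply: itop_continuous; exact: lspan_gen.
    apply: (@cfun_lspan R (itop (range coord))) => M; exact: itop_continuous.
  have VE L : lspan (range coord) L <->
      exists w : 'rV[R]_d, L = fun x : S => \sum_(k < d) w 0 k * sval x 0 k.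
    split=> [|[w ->]].
      move: L; apply: lspan_ind_closed => [|c _ _ [v ->] [w ->]|_ [k _ <-]].
      - exists 0; apply/funext => x; rewrite big1// => k _.
        by rewrite mxE mul0r.
      - exists (c *: v + w); apply/funext => x.
        rewrite mulr_sumr -big_split/=; apply: eq_bigr => k _.
        by rewrite !mxE mulrDl mulrA.
      - exists (delta_mx 0 k); apply/funext => x.
        rewrite (bigD1 k)//= mxE !eqxx mul1r big1 ?addr0// => j jk.
        by rewrite mxE (negbTE jk) andbF mul0r.
    apply: lspan_sum => k; apply: lspanZ; apply: lspan_gen.
    by exists k.
  apply/seteqP; split=> [g [n [a [b [w gE]]]]|g /lspanP[n [a [h [Hh ->]]]]].
    apply/lspanP; exists n, a,
      (fun i (x : S) => sigma (b i + \sum_(k < d) w i 0 k * sval x 0 k)).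
    split=> [i|].
      exists (fun x : S => \sum_(k < d) w i 0 k * sval x 0 k), (b i); split=> //.
      by apply/VE; exists (w i).
    apply/funext => x; rewrite gE; apply: eq_bigr => i _.
    by rewrite [b i + _]addrC.
  have /choice[wb Hwb] : forall i, exists wb : 'rV[R]_d * R, h i =
      fun x : S => sigma (\sum_(k < d) wb.1 0 k * sval x 0 k + wb.2).
    move=> i; have [_ [b [/VE[w ->] ->]]] := Hh i; exists (w, b).
    by apply/funext => x; rewrite addrC.
  exists n, a, (fun i => (wb i).2), (fun i => (wb i).1) => x.
  by apply: eq_bigr => i _; rewrite Hwb.
(* Indices beyond the dimension give the zero function, which is continuous for any topology. *)
- exists (fun n => if insub n is Some k then coord k else fun=> 0).
  rewrite base_opnE; apply: iopen_eq => [_ [k _ <-]|_ [n _ <-]].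
    by apply: itop_continuous; exists k => //; rewrite valK.
  case: insub => [k|]; first by apply: itop_continuous; exists k.
  exact: (@cfun_cst R (itop (range coord)) 0).
- exact: base_compact.
Qed.

End BaseSpace.

(** * Finite products *)

Section ProductSpace.
Context {R : realType} (sigma : R -> R).
Hypothesis sigma_cont : continuous sigma.
Hypothesis sigma_not_poly : ~ exists P : {poly R}, forall x, sigma x = P.[x].
Variables (l : nat) (X : 'I_l -> cspace R).
Hypothesis Xg : forall j, good sigma (X j).
Let S := forall j, car (X j).
Let proj j : S -> car (X j) := fun x => x j.

Let lifts (V : forall j, set (car (X j) -> R)) : set (S -> R) :=
  [set g | exists j, exists2 f, V j f & g = f \o proj j].

Let prod_opnE (V : forall j, set (car (X j) -> R)) :
  (forall j, opn (X j) = iopen (V j)) ->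
  opn (prod_space R sigma X) = iopen (lifts V).
Proof.
move=> XV; apply/seteqP; split=> U oU.
  apply: iopen_nbhs => x /oU[Q [HQ QU]].
  have : nbhs (x : itop (lifts V)) [set y | forall j, Q j (proj j y)].
    apply: (@filter_forall _ _ _ _ (@nbhs_filter (itop (lifts V)) x)) => j.
    apply: open_nbhs_nbhs; split; last by case: (HQ j).
    rewrite itop_openE; apply: (@iopen_preimage _ _ _ (proj j) _ (V j)).
      by move=> L VL; exists j, L.
    by rewrite -XV; case: (HQ j).
  by apply: filterS => y; exact: QU.
move=> x /oU[k [L [r [VL r0 LU]]]].
have nO j : nbhs (x j : itop (V j)) [set z | forall i (f : car (X j) -> R),
    V j f -> L i = f \o proj j -> `|f z - f (x j)| < r].
  apply: (@filter_forall _ _ _ _ (@nbhs_filter (itop (V j)) (x j))) => i.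
  have [[f [Vf LE]]|H] := pselect (exists f, V j f /\ L i = f \o proj j).
    have fc : continuous (f : itop (V j) -> R) by exact: itop_continuous.
    have /cvgrPdist_lt/(_ _ r0) := fc (x j).
    apply: filterS => z fz g Vg gE.
    have fgE (y : S) : f (y j) = g (y j).
      by rewrite -[LHS]/((f \o proj j) y) -LE gE.
    (* Two factorizations of [L i] through [proj j] coincide, since any [z] is the j-th coordinate
       of a modification of [x]. *)
    have := fgE (@dfwith _ (fun j => car (X j)) x j z).
    by rewrite dfwithin -fgE => <-; rewrite distrC.
  by apply: nearW => z f Vf LE; case: H; exists f.
pose Q j : set (car (X j)) := ([set z | forall i (f : car (X j) -> R),
    V j f -> L i = f \o proj j -> `|f z - f (x j)| < r] : set (itop (V j)))°.
exists Q; split=> [j|y Oy].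
  split; last exact: nO.
  by rewrite XV -itop_openE; exact: open_interior.
apply: LU => i; have [j [f Vf LE]] := VL i.
by rewrite LE; apply: (interior_subset (Oy j)) LE.
Qed.

Let prod_compact : ultra_compact (opn (prod_space R sigma X)).
Proof.
change (forall F : set_system S, UltraFilter F -> exists p : S, forall U : set S,
  opn (prod_space R sigma X) U -> U p -> F U).
move=> F FU.
(* The limits form a dependent family, hence the informative [cid] at each coordinate. *)
have H j : {z : car (X j) | forall U, opn (X j) U -> U z -> F (proj j @^-1` U)}.
  apply: cid; have [_ Xc _] := Xg j.
  by have [z Hz] := Xc _ (fmap_ultra (proj j) FU); exists z => U oU Uz; exact: Hz.
exists (fun j => sval (H j)) => U oU Ux.
have [Q [HQ QU]] := oU _ Ux.
have : F [set y | forall j, Q j (y j)].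
  by apply: filter_forall => j; have [oO Ox] := HQ j; exact: (svalP (H j)) oO Ox.
by apply: filterS => y; exact: QU.
Qed.

Let lifts_continuous (V : forall j, set (car (X j) -> R)) j f :
  continuous (f : itop (V j) -> R) ->
  continuous (f \o proj j : itop (lifts V) -> R).
Proof. by apply: itop_comp_continuous => L VL; exists j, L. Qed.

Let sums : set (S -> R) := [set g | exists a : forall j, car (X j) -> R,
  (forall j, nets (X j) (a j)) /\ g = fun x => \sum_(j < l) a j (x j)].

Let N_lin j : lin_closed (nets (X j)).
Proof. exact: good_lin. Qed.

Let sums_lin : lin_closed sums.
Proof.
split=> [|c _ _ [a [Na ->]] [b [Nb ->]]].
  exists (fun j => fun=> 0); split=> [j|]; first by case: (N_lin j).
  by apply/funext => x; rewrite big1.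
exists (fun j z => c * a j z + b j z); split=> [j|].
  by case: (N_lin j) => _; apply.
by apply/funext => x; rewrite mulr_sumr -big_split.
Qed.

Lemma good_prod : good sigma (prod_space R sigma X).
Proof.
have Hphi j : {phi : nat -> car (X j) -> R | opn (X j) = iopen (range phi)}.
  by apply: cid; case: (Xg j).
pose phi j := sval (Hphi j); have phiE j : opn (X j) = iopen (range (phi j)) := svalP (Hphi j).
have XE := prod_opnE phiE.
split; last 1 first.
- exists sums; split; first exact: sums_lin.
  + rewrite XE; apply: iopen_eq => [_ [j [f phif ->]]|_ [a [Na ->]]]; last first.
      apply: (lin_closed_sum (@cfun_lin R (itop (lifts (fun j => range (phi j)))))) => j.
      apply: (@lifts_continuous _ j (a j)); apply/(contP _ (phiE j)).
      exact: good_nets_cont.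
    (* A continuous function of one coordinate is a uniform limit of networks on that factor, and
       each of these is a member of [sums] with zero networks at the other coordinates. *)
    apply: (@cfun_ucl R (itop sums)) => e e0.
    have fc : cont f by apply/(contP _ (phiE j)); exact: itop_continuous.
    have [g Ng fg] := good_dense sigma_cont sigma_not_poly (Xg j) fc e0.
    exists (g \o proj j); last by move=> x; exact: fg.
    apply: itop_continuous.
    have N0 j' : nets (X j') (fun=> 0) by case: (N_lin j').
    exists (@dfwith _ (fun j => car (X j) -> R) (fun j' => fun=> 0) j g); split=> [j'|].
      by case: dfwithP => [|j'' _]; [exact: Ng|exact: N0].
    apply/funext => x; rewrite (bigD1 j)//= dfwithin big1 ?addr0// => j' jj'.
    by rewrite dfwithout// eq_sym.
  apply/seteqP; split=> [g [n [a [b [w [f [Nf gE]]]]]]|g /lspanP[n [a [h [Hh ->]]]]].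
    apply/lspanP; exists n, a,
      (fun i x => sigma (b i + \sum_(j < l) w i j * f i j (x j))).
    split=> [i|]; last exact/funext.
    exists (fun x => \sum_(j < l) w i j * f i j (x j)), (b i); split=> //.
    exists (fun j z => w i j * f i j z); split=> // j.
    exact: (lin_closedZ _ (N_lin j)).
  have /choice[fb Hfb] : forall i, exists fb : (forall j, car (X j) -> R) * R,
      (forall j, nets (X j) (fb.1 j)) /\ h i = fun x => sigma (fb.2 + \sum_(j < l) fb.1 j (x j)).
    by move=> i; have [_ [b [[f [Nf ->]] ->]]] := Hh i; exists (f, b).
  exists n, a, (fun i => (fb i).2), (fun _ _ => 1), (fun i => (fb i).1).
  split=> [i j|x]; first by case: (Hfb i) => + _; exact.
  apply: eq_bigr => i _; have [_ ->] := Hfb i.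
  by congr (_ * sigma (_ + _)); apply: eq_bigr => j _; rewrite mul1r.
- exists (fun n => if @unpickle ('I_l * nat)%type n is Some jn
    then phi jn.1 jn.2 \o proj jn.1 else fun=> 0).
  rewrite XE; apply: iopen_eq => [_ [j [_ [n _ <-] ->]]|_ [n _ <-]].
    by apply: itop_continuous; exists (pickle (j, n)) => //; rewrite pickleK.
  case: unpickle => [[j k]|].
    by apply: itop_continuous; exists j, (phi j k) => //; exists k.
  exact: (@cfun_cst R (itop (lifts (fun j => range (phi j)))) 0).
- exact: prod_compact.
Qed.

End ProductSpace.

Theorem theorem5 (R : realType) (sigma : R -> R)
  (sigma_cont : continuous sigma)
  (sigma_not_poly : ~ exists P : {poly R}, forall x, sigma x = P.[x])
  (X : cspace R) (HX : InClass sigma X) :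
  forall f : car X -> R, cont f ->
  forall eps : R, 0 < eps ->
  exists g, nets X g /\ forall x, `|f x - g x| < eps.
Proof.
(* Density alone would not pass through the induction; the invariant [good] does, and it implies
   density. *)
have Xg : good sigma X.
  elim: HX => [d K Kc|l Y _ _ Yg|Y x0 _ Yg].
  - exact: good_base.
  - exact: good_prod.
  - exact: good_meas.
move=> f fc eps eps0.
have [g Ng fg] := good_dense sigma_cont sigma_not_poly Xg fc eps0.
by exists g.
Qed.
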